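(* Let $(W,W',G,R)$ be an approximate Stein coupling with $W$ and $W'$ integer valued, $\mathbb{E}W=\mu$ and $\mathrm{Var}(W)=\sigma^2>0$. Set $D:=W'-W$, and let $\mathcal{F}_1,\mathcal{F}_2$ be $\sigma$-algebras such that $W$ is $\mathcal{F}_1$-measurable and $(G,D)$ is $\mathcal{F}_2$-measurable. Define \[ \Upsilon:=\mathbb{E}\big[|GD(D-1)|\,S_2(\mathcal{L}(W\mid\mathcal{F}_2))\big],\qquad T:=\big|\mathbb{E}[GD\mid\mathcal{F}_1]-\mathbb{E}[GD]\big|. \] If $c_1$ satisfies $\max\{\Upsilon+1,\ \|R\|_2,\ \sigma^{-1}\|T\|_2\}\le c_1$, then \[ d_{\mathrm{TV}}\big(\mathcal{L}(W),\mathrm{TP}(\mu,\sigma^2)\big)\le 5c_1\sigma^{-1}. \] If in addition $c_2$ satisfies $\sigma^{-1}\|T\|_q\le c_2$ with $q=\lceil\log\sigma\rceil$, and $c_1+ec_2<\sigma/2$, then \[ d_{\mathrm{loc}}\big(\mathcal{L}(W),\mathrm{TP}(\mu,\sigma^2)\big)\le 4(4c_1+ec_2)\sigma^{-2}. \]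
   Context: $(W,W',G,R)$ is an approximate Stein coupling if $\mathbb{E}[(W-\mu)f(W)]=\mathbb{E}[G(f(W')-f(W))]+\mathbb{E}[Rf(W)]$ for all $f$ for which the expectations exist. For a random variable $X$ and $q>0$, $\|X\|_q:=(\mathbb{E}|X|^q)^{1/q}$. For an integer-valued law $\mathcal{L}(W)$, $S_2(\mathcal{L}(W)):=\sup_{h:\mathbb{Z}\to\mathbb{R},\,\|h\|_\infty\le1}|\mathbb{E}\Delta^2h(W)|$, where $\Delta^2h(i)=h(i+2)-2h(i+1)+h(i)$; $S_2(\mathcal{L}(W\mid\mathcal{F}_2))$ denotes the same quantity computed for the conditional law given $\mathcal{F}_2$ (a random variable). $d_{\mathrm{TV}}(\mathcal{L}(X),\mathcal{L}(Y))=\sup_{A\subseteq\mathbb{Z}}|\mathbb{P}(X\in A)-\mathbb{P}(Y\in A)|$ and $d_{\mathrm{loc}}(\mathcal{L}(X),\mathcal{L}(Y))=\sup_{a\in\mathbb{Z}}|\mathbb{P}(X=a)-\mathbb{P}(Y=a)|$. $\mathrm{TP}(\mu,\sigma^2)$ is the law of $Z$ with $Z-s\sim\mathrm{Po}(\sigma^2+\gamma)$, where $s=\lfloor\mu-\sigma^2\rfloor$ and $\gamma=\mu-\sigma^2-s$. *)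

(* Defs.v *)
From HB Require Import structures.
From mathcomp Require Import all_boot all_order all_algebra.
From mathcomp Require Import all_classical all_reals all_analysis.
Set Implicit Arguments. Unset Strict Implicit. Unset Printing Implicit Defensive.
Import Order.TTheory GRing.Theory Num.Theory.
Local Open Scope classical_set_scope.
Local Open Scope ring_scope.

Section defs.
Context {d : measure_display} {T : measurableType d} {R : realType}.
Variable P : probability T R.

Definition sub_sigma (F : set (set T)) : Prop :=
  sigma_algebra setT F /\ F `<=` measurable.

Definition F_measurable (F : set (set T)) (X : T -> R) : Prop :=
  forall B : set R, measurable B -> F (X @^-1` B).

Definition cond_exp_version (F : set (set T)) (X Y : T -> R) : Prop :=
  [/\ P.-integrable setT (EFin \o X), F_measurable F Y,
      P.-integrable setT (EFin \o Y) &
      forall A, F A -> (\int[P]_(x in A) (X x)%:E = \int[P]_(x in A) (Y x)%:E)%E].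

Definition cond_law_version (F : set (set T)) (W : T -> int) (p : int -> T -> R) : Prop :=
  (forall k, cond_exp_version F (\1_(W @^-1` [set k])) (p k)) /\
  (forall x, (forall k, 0 <= p k x) /\ (\esum_(k in [set: int]) (p k x)%:E = 1)%E).

End defs.

Definition sumZ {R : realType} (f : int -> R) : \bar R :=
  (\esum_(k in [set: int]) (Num.max (f k) 0)%:E
   - \esum_(k in [set: int]) (Num.max (- f k) 0)%:E)%E.

Definition Delta2 {R : realType} (h : int -> R) (i : int) : R :=
  h (i + 2)%R - 2 * h (i + 1)%R + h i.

Definition S2 {R : realType} (p : int -> R) : \bar R :=
  ereal_sup [set `|sumZ (fun k => (Delta2 h k * p k)%R)|%E
            | h in [set h : int -> R | forall i, `|h i| <= 1]].

(* probability mass function of TP(mu, sigma2): Z - s ~ Po(sigma2 + gamma) *)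
Definition TP_pmf {R : realType} (mu sigma2 : R) (k : int) : R :=
  let s : int := Num.floor (mu - sigma2) in
  let gam : R := mu - sigma2 - s%:~R in
  if (s <= k)%R then poisson_pmf (sigma2 + gam) `|k - s|%N else 0.

Section dist.
Context {d : measure_display} {T : measurableType d} {R : realType}.
Variable P : probability T R.

Definition dTV (W : T -> int) (q : int -> R) : \bar R :=
  ereal_sup [set `|P (W @^-1` A) - \esum_(k in A) (q k)%:E|%E | A in [set: set int]].

Definition dloc (W : T -> int) (q : int -> R) : \bar R :=
  ereal_sup [set `|P (W @^-1` [set a]) - (q a)%:E|%E | a in [set: int]].
End dist.

(* Main.v *)
Require Import Defs.
From HB Require Import structures.
From mathcomp Require Import all_boot all_order all_algebra.
From mathcomp Require Import all_classical all_reals all_analysis.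
From mathcomp Require Import measurable_realfun ring lra zify.
Import Order.TTheory GRing.Theory Num.Theory.
Local Open Scope classical_set_scope.
Local Open Scope ring_scope.
Import numFieldNormedType.Exports.

(* Stein's method for the translated Poisson law.  For a set [A], the solution [f] of
   [lam f(w+1) - w f(w) = 1_A(w) - Po(lam)(A)] satisfies [|f| <= 2 / sqrt lam] for
   [lam >= 25] and [|f(w+1) - f(w)| <= 1 / lam].  The coupling replaces [E (W - mu) f(W)] by
   [E GD E Df(W)] up to four errors: the Taylor remainder, which conditionally on F2
   is an average of second differences of [f] and hence costs at most
   [|f| E |GD(D-1)| S2 / 2]; the fluctuation of [E(GD | F1)]; the remainder R; and
   [|E GD - sigma^2|], which the coupling with the identity function bounds by
   [sigma |R|_2].  With the bounds on [f] this gives the total variation estimate.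

   For the point mass at [a], [f] is at most [1 / lam], its increments are nonpositive
   off [a], and the increment at [a] and the others each have total mass at most
   [1 / lam].  Hence [|E Df(W)|] is at most [1 / lam], and [E |Df(W)|] at most
   [2 / lam], times the largest point probability of W, which exceeds the local
   distance by at most the Poisson mode, [0.45 / sigma].  Hoelder's inequality with
   exponent [q] about [log sigma] handles the fluctuation term at the price of a
   factor [e], and the local distance is bounded in terms of itself.  To close the
   argument with the stated constants, the factor 2 is lowered: by Chebyshev's
   inequality a large local error at [a] forces [a] to be close to [mu], where the
   off-point increments of [f] are of order [1 / (lam sqrt sigma)]. *)

(** * Sums over the integers and second-order Taylor remainders *)

Section sums_over_int.
Context {R : realType}.
Implicit Types (f g h p : int -> R) (a : int -> \bar R).

Definition int_enum (n : nat) : int := if odd n then Negz n./2 else Posz n./2.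

Lemma int_enum_inj : injective int_enum.
Proof.
move=> m n; rewrite /int_enum; move: (odd_double_half m) (odd_double_half n).
by case: (odd m); case: (odd n) => // {2}<- {2}<- [->].
Qed.

Lemma int_enum_surj k : exists n, int_enum n = k.
Proof.
case: k => n; [exists n.*2|exists n.*2.+1]; rewrite /int_enum /= odd_double//=.
  by rewrite doubleK.
by rewrite uphalf_double.
Qed.

Lemma int_enum_bij : set_bij [set: nat] [set: int] int_enum.
Proof.
split=> //; first by move=> m n _ _; exact: int_enum_inj.
by move=> k _; have [n <-] := int_enum_surj k; exists n.
Qed.

Lemma esum_int a : (forall k, 0 <= a k)%E ->
  (\esum_(k in [set: int]) a k = \sum_(n <oo) a (int_enum n))%E.
Proof.
by move=> a0; rewrite (reindex_esum _ _ _ _ int_enum_bij)//= -nneseries_esumT.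
Qed.

Lemma esum_intZ (c : R) a : 0 <= c -> (forall k, 0 <= a k)%E ->
  (\esum_(k in [set: int]) (c%:E * a k) = c%:E * \esum_(k in [set: int]) a k)%E.
Proof.
move=> c0 a0; rewrite !esum_int//; first by rewrite nneseriesZl.
by move=> k; rewrite mule_ge0.
Qed.

Notation summableZ f := (summable [set: int] (EFin \o f)).

Lemma sumZE f : sumZ f = (\esum_(k in [set: int]) ((EFin \o f)^\+ k)
  - \esum_(k in [set: int]) ((EFin \o f)^\- k))%E.
Proof.
by congr (_ - _)%E; apply: eq_esum => k _;
  rewrite ?funeposE ?funenegE /= -?EFinN -EFin_max.
Qed.

Lemma eq_sumZ f g : f =1 g -> sumZ f = sumZ g.
Proof. by move/funext => ->. Qed.

Lemma sumZB f g : summableZ f -> summableZ g ->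
  (forall k, 0 <= f k) -> (forall k, 0 <= g k) ->
  sumZ (fun k => f k - g k) =
  (\esum_(k in [set: int]) (f k)%:E - \esum_(k in [set: int]) (g k)%:E)%E.
Proof.
move=> sf sg f0 g0; rewrite sumZE.
exact: (esumB sf sg (fun k _ => f0 k) (fun k _ => g0 k)).
Qed.

Lemma summableZ_dominated f g : (forall k, `|f k| <= g k) -> summableZ g ->
  summableZ f.
Proof.
move=> fg; apply: le_lt_trans; apply: le_esum => k _ /=.
by rewrite lee_fin (le_trans (fg k))// ler_norm.
Qed.

Lemma sumZD f g : summableZ f -> summableZ g ->
  sumZ (fun k => f k + g k) = (sumZ f + sumZ g)%E.
Proof.
move=> sf sg.
pose u k : R := Num.max (f k) 0; pose u' k : R := Num.max (- f k) 0.
pose v k : R := Num.max (g k) 0; pose v' k : R := Num.max (- g k) 0.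
have mx (x : R) : Num.max x 0 + Num.max (- x) 0 = `|x| /\
    x = Num.max x 0 - Num.max (- x) 0.
  have [h|h] := lerP 0 x.
    by rewrite max_r ?oppr_le0// ger0_norm// addr0 subr0.
  rewrite max_l ?oppr_ge0 ?(ltW h)// ltr0_norm// add0r.
  by rewrite sub0r opprK.
have absf k : u k + u' k = `|f k| by rewrite (mx _).1.
have absg k : v k + v' k = `|g k| by rewrite (mx _).1.
have fE k : f k = u k - u' k by exact: (mx _).2.
have gE k : g k = v k - v' k by exact: (mx _).2.
have u0 k : 0 <= u k by rewrite le_max lexx orbT.
have u'0 k : 0 <= u' k by rewrite le_max lexx orbT.
have v0 k : 0 <= v k by rewrite le_max lexx orbT.
have v'0 k : 0 <= v' k by rewrite le_max lexx orbT.
have sdom (w w' : int -> R) t : (forall k, 0 <= w k) -> (forall k, 0 <= w' k) ->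
    (forall k, w k + w' k = `|t k|) -> summableZ t -> summableZ w /\ summableZ w'.
  move=> w0 w'0 wt st; have sat : summableZ (fun k => `|t k|).
    by apply: le_lt_trans st; apply: le_esum => k _ /=; rewrite normr_id.
  by split; apply: summableZ_dominated sat => k;
    rewrite -wt ger0_norm// ?lerDl ?lerDr.
have [su su'] := sdom _ _ _ u0 u'0 absf sf.
have [sv sv'] := sdom _ _ _ v0 v'0 absg sg.
rewrite (eq_sumZ _ (fun k => u k - u' k) fE) (eq_sumZ _ (fun k => v k - v' k) gE).
rewrite !sumZB//.
rewrite (eq_sumZ _ (fun k => (u k + v k) - (u' k + v' k))); last first.
  by move=> k; rewrite fE gE opprD addrACA.
have fin (w : int -> R) : (forall k, 0 <= w k) -> summableZ w ->
    (\esum_(k in [set: int]) (w k)%:E)%E \is a fin_num.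
  move=> w0; rewrite summableE; under eq_esum do rewrite /= ger0_norm//.
  by [].
have suv : summableZ (fun k => u k + v k) by exact: (summableD su sv).
have suv' : summableZ (fun k => u' k + v' k) by exact: (summableD su' sv').
rewrite (sumZB _ _ suv suv'); [|by move=> k; exact: addr_ge0..].
under eq_esum do rewrite EFinD.
rewrite esumD; [|by move=> *; rewrite lee_fin..].
under [X in (_ - X)%E]eq_esum do rewrite EFinD.
rewrite [X in (_ - X)%E]esumD; [|by move=> *; rewrite lee_fin..].
by rewrite fin_num_oppeD ?fin// addeACA.
Qed.

Lemma sumZN f : summableZ f -> sumZ (fun k => - f k) = (- sumZ f)%E.
Proof.
move=> sf; rewrite /sumZ oppeB; last first.
  apply: fin_num_adde_defl; rewrite fin_numN ge0_fin_numE; last first.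
    by apply: esum_ge0 => k _; rewrite lee_fin le_max lexx orbT.
  apply: le_lt_trans sf; apply: le_esum => k _ /=.
  by rewrite lee_fin ge_max normr_ge0 -normrN ler_norm.
by rewrite addeC; under eq_esum do rewrite opprK.
Qed.

Lemma sumZZ (c : R) f : summableZ f ->
  sumZ (fun k => c * f k) = (c%:E * sumZ f)%E.
Proof.
have sc (b : R) g : summableZ g -> 0 <= b -> summableZ (fun k => b * g k).
  move=> sg b0; rewrite /summable.
  rewrite (eq_esum (b := fun k => (b%:E * `|(g k)%:E|)%E)); last first.
    by move=> k _; rewrite /= normrM EFinM ger0_norm.
  by rewrite esum_intZ//; apply: lte_mul_pinfty => //; rewrite lee_fin.
have pos (b : R) g : summableZ g -> 0 <= b ->
    sumZ (fun k => b * g k) = (b%:E * sumZ g)%E.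
  move=> sg b0; rewrite {2}/sumZ muleBr//; last first.
    apply: fin_num_adde_defl; rewrite fin_numN ge0_fin_numE; last first.
      by apply: esum_ge0 => k _; rewrite lee_fin le_max lexx orbT.
    apply: le_lt_trans sg; apply: le_esum => k _ /=.
    by rewrite lee_fin ge_max normr_ge0 -normrN ler_norm.
  rewrite -!esum_intZ//; [|by move=> k; rewrite lee_fin le_max lexx orbT..].
  congr (_ - _)%E; apply: eq_esum => k _; rewrite -EFinM maxr_pMr// mulr0//.
  by rewrite mulrN.
move=> sf; have [c0|/ltW c0] := leP 0 c; first exact: pos.
rewrite -(opprK c); have nc0 : 0 <= - c by rewrite oppr_ge0.
rewrite (eq_sumZ _ (fun k => - (- c * f k))) => [|k]; last by rewrite mulNr.
by rewrite sumZN ?pos// ?[in RHS]EFinN ?mulNe//; exact: sc.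
Qed.

Section weights.
Variable p : int -> R.
Hypotheses (p0 : forall k, 0 <= p k) (p1 : summableZ p).

Lemma summable_bounded h (B : R) : (forall k, `|h k| <= B) ->
  summableZ (fun k => h k * p k).
Proof.
move=> hB; apply: (@summableZ_dominated _ (fun k => B * p k)).
  by move=> k; rewrite normrM (ger0_norm (p0 k)) ler_wpM2r.
have B0 : 0 <= B by exact: le_trans (hB 0).
rewrite /summable (eq_esum (b := fun k => (B%:E * `|(p k)%:E|)%E)); last first.
  by move=> k _; rewrite /= normrM EFinM ger0_norm.
by rewrite esum_intZ//; apply: lte_mul_pinfty => //; rewrite lee_fin.
Qed.

Variables (f : int -> R) (B : R).
Hypothesis fB : forall k, `|f k| <= B.

Lemma sumZ_Delta2_le j :
  (`|sumZ (fun k => (Delta2 f (k + j) * p k)%R)| <= B%:E * S2 p)%E.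
Proof.
have [B0|B0] := eqVneq B 0.
  rewrite (eq_sumZ _ (fun k => 0 * p k)); last first.
    have f0 k : f k = 0 by have := fB k; rewrite B0 normr_le0 => /eqP.
    by move=> k; rewrite /Delta2 !f0 mulr0 subr0 addr0.
  by rewrite sumZZ// mul0e abse0 B0 mul0e.
have Bp : 0 < B by rewrite lt_neqAle eq_sym B0 (le_trans _ (fB 0)).
pose h k : R := f (k + j) / B.
have h1 k : `|h k| <= 1.
  by rewrite normrM normfV (gtr0_norm Bp) ler_pdivrMr// mul1r.
rewrite (eq_sumZ _ (fun k => B * (Delta2 h k * p k))); last first.
  move=> k; rewrite mulrA; congr (_ * _).
  rewrite /h /Delta2 !(addrAC k _ j); field; exact: B0.
rewrite sumZZ; last first.
  apply: (@summable_bounded _ 4) => k; rewrite /Delta2.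
  have := h1 (k + 2)%R; have := h1 (k + 1)%R; have := h1 k.
  by rewrite !ler_norml; lra.
rewrite abseM /= gtr0_norm//; apply: lee_wpmul2l; first by rewrite lee_fin ltW.
by apply: ereal_sup_ubound; exists h.
Qed.

Definition taylor2 (k m : int) : R := f (m + k) - f m - k%:~R * (f (m + 1) - f m).

Lemma taylor2_bounded k m : `|taylor2 k m| <= (2 + 2 * `|k%:~R|) * B.
Proof.
rewrite /taylor2; apply: (le_trans (ler_normB _ _)); rewrite normrM.
have h i j : `|f i - f j| <= 2 * B.
  have := fB i; have := fB j; rewrite !ler_norml; lra.
rewrite mulrDl; apply: lerD; first exact: h.
by rewrite mulrAC [leRHS]mulrC ler_wpM2l.
Qed.

Lemma S2_ge0 : (0 <= S2 p)%E.
Proof.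
apply: ereal_sup_ubound; exists (fun=> 0) => [i|]; first by rewrite normr0.
rewrite (eq_sumZ _ (fun k => 0 * p k)) ?sumZZ ?mul0e ?abse0// => k.
by rewrite /Delta2 mulr0 subr0 addr0.
Qed.

Let le_sumZ_weight (u v w : int -> R) (Bu Bv a b c : R) (s : bool) :
  (forall k, `|u k| <= Bu) -> (forall k, `|v k| <= Bv) ->
  (forall k, w k = u k + (-1) ^+ s * v k) -> 0 <= a -> 0 <= b -> a + b = c ->
  (`|sumZ (fun k => u k * p k)%R| <= a%:E * (B%:E * S2 p))%E ->
  (`|sumZ (fun k => v k * p k)%R| <= b%:E * (B%:E * S2 p))%E ->
  (`|sumZ (fun k => w k * p k)%R| <= c%:E * (B%:E * S2 p))%E.
Proof.
move=> uB vB wE a0 b0 <- ul vl.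
have sv : summableZ (fun k => v k * p k) by exact: summable_bounded vB.
rewrite (eq_sumZ _ (fun k => u k * p k + (-1) ^+ s * (v k * p k))); last first.
  by move=> k; rewrite wE mulrDl mulrA.
rewrite sumZD; [|exact: summable_bounded uB|]; last first.
  have := @summable_bounded (fun k => (-1) ^+ s * v k) Bv.
  by under eq_fun do rewrite -mulrA; apply => k; rewrite normrMsign.
rewrite EFinD ge0_muleDl ?lee_fin// sumZZ//.
apply: (le_trans (lee_abs_add _ _)); apply: leeD => //.
by rewrite abseM /= normr_sign mul1e.
Qed.

Let d (k m : int) : R := (f (m + k + 1) - f (m + k)) - (f (m + 1) - f m).

Let d_bounded k m : `|d k m| <= 4 * B.
Proof.
rewrite /d; have := fB (m + k + 1); have := fB (m + k); have := fB (m + 1).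
by have := fB m; rewrite !ler_norml; lra.
Qed.

Let Delta2_bounded k m : `|Delta2 f (m + k)| <= 4 * B.
Proof.
rewrite /Delta2; have := fB (m + k + 2); have := fB (m + k + 1).
by have := fB (m + k); rewrite !ler_norml; lra.
Qed.

Let sumZ_d_le k :
  (`|sumZ (fun m => d k m * p m)%R| <= `|k%:~R|%:E * (B%:E * S2 p))%E.
Proof.
elim/int_rec: k => [|n IH|n IH].
- rewrite (eq_sumZ _ (fun m => 0 * p m)) ?sumZZ ?mul0e ?abse0 ?normr0 ?mul0e//.
  by move=> m; rewrite /d addr0 subrr.
- apply: (le_sumZ_weight _ _ _ _ _ _ 1 _ false (d_bounded n)
    (Delta2_bounded n) _ _ _ _ IH) => //.
  + move=> m; rewrite expr0 mul1r /d /Delta2 -!addrA.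
    by rewrite (_ : n.+1%:Z = n%:Z + 1) ?(addrA n%:Z) -?intS ?addn1//; [ring|lia].
  + by rewrite -!pmulrn !ger0_norm ?ler0n// -natr1.
  + by rewrite mul1e; exact: sumZ_Delta2_le.
- apply: (le_sumZ_weight _ _ _ _ _ _ 1 _ true (d_bounded (- n%:Z))
    (Delta2_bounded (- n.+1%:Z)) _ _ _ _ IH) => //.
  + move=> m; rewrite expr1 mulN1r /d /Delta2.
    have -> : m - n%:Z = m - n.+1%:Z + 1 by lia.
    by rewrite -(addrA _ 1 1); ring.
  + by rewrite !mulrNz !normrN -!pmulrn !ger0_norm ?ler0n// -natr1.
  + by rewrite mul1e; exact: sumZ_Delta2_le.
Qed.

(* The increments of [k |-> taylor2 k m] are themselves sums of [|k|] second
   differences, which gives the weight [|k (k - 1)| / 2]. *)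
Lemma sumZ_taylor2_le k :
  (`|sumZ (fun m => taylor2 k m * p m)%R|
    <= (`|k%:~R * (k%:~R - 1)| / 2)%:E * (B%:E * S2 p))%E.
Proof.
elim/int_rec: k => [|n IH|n IH].
- rewrite (eq_sumZ _ (fun m => 0 * p m)); last first.
    by move=> m; rewrite /taylor2 addr0 subrr !mul0r subr0 mul0r.
  by rewrite sumZZ// !mul0r normr0 !mul0r !mul0e abse0.
- apply: (le_sumZ_weight _ _ _ _ _ _ _ _ false (taylor2_bounded n)
    (d_bounded n) _ _ _ _ IH (sumZ_d_le n)) => //.
  + move=> m; rewrite expr0 mul1r /d /taylor2.
    by rewrite (_ : m + n.+1%:Z = m + n%:Z + 1) ?intS ?intrD; [ring|lia].
  + rewrite -!pmulrn -(natr1 n) addrK; case: n {IH} => [|n].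
      by rewrite !mul0r normr0 mul0r mulr0 normr0 mul0r addr0.
    rewrite -(natr1 n) addrK.
    have n0 : (0 : R) <= n%:R by exact: ler0n.
    by rewrite !ger0_norm; nra.
- apply: (le_sumZ_weight _ _ _ _ _ _ _ _ true (taylor2_bounded (- n%:Z))
    (d_bounded (- n.+1%:Z)) _ _ _ _ IH (sumZ_d_le _)) => //.
  + move=> m; rewrite expr1 mulN1r /d /taylor2.
    rewrite (_ : m - n.+1%:Z + 1 = m - n%:Z); last lia.
    by rewrite !mulrNz intS intrD; ring.
  + rewrite !mulrNz normrN -!pmulrn -(natr1 n).
    have n0 : (0 : R) <= n%:R by exact: ler0n.
    by rewrite -!opprD !mulrN !mulNr !normrN !ger0_norm; nra.
Qed.
End weights.
End sums_over_int.

(** * Poisson weights and the Stein equation *)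

Section poisson_mass.
Context {R : realType}.
Variable lam : R.
Hypothesis lam0 : 0 < lam.
Notation pi := (@poisson_pmf R lam).

Lemma poisson_pmf_gt0 k : 0 < pi k.
Proof.
by rewrite /poisson_pmf lam0 !mulr_gt0 ?exprn_gt0 ?invr_gt0 ?ltr0n ?fact_gt0 ?expR_gt0.
Qed.

Lemma poisson_pmfS k : k.+1%:R * pi k.+1 = lam * pi k.
Proof.
rewrite /poisson_pmf lam0 factS natrM exprS.
have k0 : k.+1%:R != 0 :> R by rewrite pnatr_eq0.
have f0 : (k`!)%:R != 0 :> R by rewrite pnatr_eq0 -lt0n fact_gt0.
by move: (k.+1%:R : R) k0 => a a0; field; rewrite f0 a0.
Qed.

Definition poisson_cdf (w : nat) : R := \sum_(j < w) pi j.
Notation F := poisson_cdf.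

Lemma poisson_cdf0 : F 0 = 0. Proof. by rewrite /F big_ord0. Qed.

Lemma poisson_cdfS w : F w.+1 = F w + pi w.
Proof. by rewrite /F big_ord_recr. Qed.

Lemma poisson_cdf_ge0 w : 0 <= F w.
Proof. by apply: sumr_ge0 => j _; exact: poisson_pmf_ge0. Qed.

Lemma poisson_cdf_nd m n : (m <= n)%N -> F m <= F n.
Proof.
move=> /subnK <-; elim: (n - m)%N => [|i IH]; first by rewrite add0n.
by rewrite addSn poisson_cdfS (le_trans IH)// lerDl poisson_pmf_ge0.
Qed.

Lemma esum_poisson_pmf : (\esum_(k in [set: nat]) (pi k)%:E = 1)%E.
Proof.
have := @probability_setT _ _ _ (poisson_prob lam 0).
by rewrite /= /poisson_prob lam0.
Qed.

Lemma poisson_cdf_le1 w : F w <= 1.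
Proof.
rewrite -lee_fin -esum_poisson_pmf -nneseries_esumT; last first.
  by move=> n; rewrite lee_fin poisson_pmf_ge0.
rewrite /F -sumEFin -(big_mkord xpredT (fun j => (pi j)%:E)).
by apply: nneseries_lim_ge => n _; rewrite lee_fin poisson_pmf_ge0.
Qed.

Lemma poisson_cdf_lim C : (forall w, F w <= C) -> 1 <= C.
Proof.
move=> FC; rewrite -lee_fin -esum_poisson_pmf -nneseries_esumT; last first.
  by move=> n; rewrite lee_fin poisson_pmf_ge0.
apply: lime_le; first by apply: is_cvg_nneseries => n _; rewrite lee_fin poisson_pmf_ge0.
by apply: nearW => w; rewrite sumEFin lee_fin big_mkord FC.
Qed.

Definition lowtail (w : nat) : R := F w / (w%:R * pi w).
Definition uptail (w : nat) : R := (1 - F w) / (w%:R * pi w).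
Notation g := lowtail.
Notation h := uptail.

Let pi0 k : pi k != 0. Proof. exact: lt0r_neq0 (poisson_pmf_gt0 k). Qed.
Let lamN0 : lam != 0. Proof. exact: lt0r_neq0. Qed.

Lemma lowtail_ge0 w : 0 <= g w.
Proof. by rewrite divr_ge0 ?poisson_cdf_ge0// mulr_ge0// poisson_pmf_ge0. Qed.

Lemma uptail_ge0 w : 0 <= h w.
Proof.
by rewrite divr_ge0 ?subr_ge0 ?poisson_cdf_le1// mulr_ge0// poisson_pmf_ge0.
Qed.

Lemma lowtail0 : g 0 = 0. Proof. by rewrite /g poisson_cdf0 mul0r. Qed.

Lemma lowtailSE w : lam * pi w * g w.+1 = F w.+1.
Proof. by rewrite /g poisson_pmfS mulrC divfK// mulf_neq0. Qed.

Lemma uptailSE w : lam * pi w * h w.+1 = 1 - F w.+1.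
Proof. by rewrite /h poisson_pmfS mulrC divfK// mulf_neq0. Qed.

Lemma tailsE w : lam * pi w * (g w.+1 + h w.+1) = 1.
Proof. by rewrite mulrDr lowtailSE uptailSE addrC subrK. Qed.

Lemma lowtailE w : w%:R * pi w * g w = F w.
Proof.
case: w => [|w]; first by rewrite mul0r mul0r poisson_cdf0.
by rewrite poisson_pmfS lowtailSE.
Qed.

Lemma lowtailS w : lam * g w.+1 = w%:R * g w + 1.
Proof.
apply: (mulfI (pi0 w)); have := lowtailSE w; rewrite poisson_cdfS -{1}lowtailE.
by move=> E; rewrite mulrA [_ * lam]mulrC E; ring.
Qed.

Lemma uptailS w : lam * h w.+2 = w.+1%:R * h w.+1 - 1.
Proof.
apply: (mulfI (pi0 w.+1)); rewrite mulrA [_ * lam]mulrC uptailSE poisson_cdfS.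
have := uptailSE w; rewrite -poisson_pmfS => E.
have -> : 1 - (F w.+1 + pi w.+1) = (1 - F w.+1) - pi w.+1 by ring.
by rewrite -E; ring.
Qed.

Let pi_ratio i j : (i <= j)%N -> pi j.+1 * pi i <= pi j * pi i.+1.
Proof.
move=> ij; have j0 : 0 < j.+1%:R :> R by rewrite ltr0n.
have i0 : 0 < i.+1%:R :> R by rewrite ltr0n.
rewrite -(ler_pM2l (mulr_gt0 i0 j0)).
have -> : i.+1%:R * j.+1%:R * (pi j.+1 * pi i)
    = i.+1%:R * (j.+1%:R * pi j.+1) * pi i by ring.
have -> : i.+1%:R * j.+1%:R * (pi j * pi i.+1)
    = j.+1%:R * (i.+1%:R * pi i.+1) * pi j by ring.
rewrite !poisson_pmfS.
have -> : i.+1%:R * (lam * pi j) * pi i = i.+1%:R * (lam * pi j * pi i) by ring.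
have -> : j.+1%:R * (lam * pi i) * pi j = j.+1%:R * (lam * pi j * pi i) by ring.
by rewrite ler_wpM2r ?ler_nat// !mulr_ge0 ?ltW ?poisson_pmf_gt0.
Qed.

Lemma lowtail_nd w : g w <= g w.+1.
Proof.
case: w => [|w]; first by rewrite lowtail0 lowtail_ge0.
have key v : (v <= w)%N -> F v.+1 * pi w.+1 <= F v.+2 * pi w.
  elim: v => [|v IH] vw.
    rewrite !poisson_cdfS poisson_cdf0 add0r mulrDl mulrC.
    have := pi_ratio 0 w vw; have := poisson_pmf_gt0 0; have := poisson_pmf_gt0 w.
    move=> a b; have : 0 < pi 0 * pi w by exact: mulr_gt0.
    by lra.
  rewrite [F v.+2]poisson_cdfS [F v.+3]poisson_cdfS !mulrDl lerD//.
    by apply: IH; exact: ltnW.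
  by rewrite mulrC [leRHS]mulrC; have := pi_ratio _ _ vw; rewrite mulrC.
rewrite -(ler_pM2l (poisson_pmf_gt0 w.+1)) -(ler_pM2l lam0).
rewrite -(ler_pM2l (poisson_pmf_gt0 w)).
have -> : pi w * (lam * (pi w.+1 * g w.+1)) = pi w.+1 * (lam * pi w * g w.+1).
  by ring.
have -> : pi w * (lam * (pi w.+1 * g w.+2)) = pi w * (lam * pi w.+1 * g w.+2).
  by ring.
by rewrite !lowtailSE mulrC [leRHS]mulrC; exact: key.
Qed.

Lemma uptail_ni w : h w.+2 <= h w.+1.
Proof.
have key n : (F (n + w.+2) - F w.+2) * pi w <= (F (n + w.+1) - F w.+1) * pi w.+1.
  elim: n => [|n IH]; first by rewrite !add0n !subrr !mul0r.
  rewrite !addSn ![F _.+1]poisson_cdfS.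
  have := pi_ratio w (n + w.+1)%N (leq_trans (leqnSn w) (leq_addl _ _)).
  by rewrite -addnS; move: IH; rewrite !poisson_cdfS; lra.
rewrite -(ler_pM2l (poisson_pmf_gt0 w.+1)) -(ler_pM2l lam0).
rewrite -(ler_pM2l (poisson_pmf_gt0 w)).
have -> : pi w * (lam * (pi w.+1 * h w.+1)) = pi w.+1 * (lam * pi w * h w.+1).
  by ring.
have -> : pi w * (lam * (pi w.+1 * h w.+2)) = pi w * (lam * pi w.+1 * h w.+2).
  by ring.
rewrite !uptailSE -ler_pdivlMl// ?poisson_pmf_gt0// lerBlDr.
apply: poisson_cdf_lim => n; apply: (le_trans (poisson_cdf_nd _ _ (leq_addr w.+2 n))).
rewrite -lerBlDr ler_pdivlMl ?poisson_pmf_gt0// mulrC (le_trans (key n))// mulrC.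
by rewrite ler_wpM2l ?poisson_pmf_ge0// lerB// poisson_cdf_le1.
Qed.

Lemma uptail_ni_add w k : h (w.+1 + k)%N <= h w.+1.
Proof.
elim: k => [|k IH]; first by rewrite addn0.
by rewrite addnS (le_trans _ IH)// addSn uptail_ni.
Qed.

Lemma lowtail_nd_add w k : g w <= g (w + k)%N.
Proof.
elim: k => [|k IH]; first by rewrite addn0.
by rewrite addnS (le_trans IH)// lowtail_nd.
Qed.

Let lowtail_sub_le w : (lam - w%:R) * g w <= 1.
Proof.
have := lowtail_nd w; rewrite -(ler_pM2l lam0) lowtailS; lra.
Qed.

Let uptail_sub_le w : (w.+1%:R - lam) * h w.+1 <= 1.
Proof.
have := uptail_ni w; rewrite -(ler_pM2l lam0) uptailS; lra.
Qed.

Variable rt : R.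
Hypotheses (rt2 : rt * rt = lam) (rt_ge5 : 5 <= rt).

Let step_exists : exists k : nat, rt <= k%:R /\ k%:R <= rt + 1.
Proof.
exists `|Num.ceil rt|%N.
have r5 := rt_ge5.
have c0 : 0 <= Num.ceil rt by rewrite -(ler0z R) (le_trans _ (ceil_ge _))//; lra.
rewrite natr_absz ger0_norm//; split; first exact: ceil_ge.
by have := ceilB1_lt rt; rewrite intrB; lra.
Qed.

(* By [uptailS] each step to the right lowers [h] by at most [1 / lam], and by less
   the farther [w] is from [lam]; after [k] steps, with [k] about [rt], what is left
   is at most [1 / k] by [uptail_sub_le]. *)
Lemma uptail_le w : lam <= w.+1%:R -> h w.+1 <= 2 / rt.
Proof.
move=> lw; have r5 := rt_ge5; have [k [k1 k2]] := step_exists.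
set H := h (w.+1 + k)%N.
have H0 : 0 <= H by exact: uptail_ge0.
have key j : (j <= k)%N ->
    lam * (h w.+1 - h (w.+1 + j)%N) <= j%:R - H * (j%:R * (j%:R - 1) / 2).
  elim: j => [|j IH] jk; first by rewrite addn0; lra.
  have := IH (ltnW jk).
  have -> : j.+1%:R = j%:R + 1 :> R by rewrite natr1.
  have := uptailS (w + j); rewrite addnS addSn => E.
  have Hj : H <= h (w + j).+1.
    have := uptail_ni_add (w + j) (k - j); rewrite /H.
    by rewrite !addSn -addnA subnKC// ltnW.
  have : j%:R * H <= ((w + j).+1%:R - lam) * h (w + j).+1.
    apply: ler_pM => //; rewrite ?ler0n//.
    have : (w + j).+1%:R = w.+1%:R + j%:R :> R by rewrite -natrD addSn.
    by lra.
  by lra.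
have := key k (leqnn k); rewrite -/H => K.
have HK : k%:R * H <= 1.
  have := uptail_sub_le (w + k); rewrite -addSn -/H; apply: le_trans.
  by apply: ler_wpM2r => //; rewrite natrD; lra.
have kk : 0 <= lam - k%:R * (k%:R - 1) / 2 by rewrite -rt2; nra.
have rp : 0 < rt by lra.
rewrite ler_pdivlMr// -(ler_pM2l rp) (mulrC (h _)) mulrA rt2.
have L1 : lam * h w.+1 <= k%:R + H * (lam - k%:R * (k%:R - 1) / 2) by lra.
have k0 : 0 < k%:R :> R by lra.
have L2 : H * (lam - k%:R * (k%:R - 1) / 2) <= rt - (k%:R - 1) / 2.
  rewrite -(ler_pM2l k0) mulrA (le_trans (ler_wpM2r kk HK))// mul1r.
  have : rt * rt <= rt * k%:R by rewrite ler_wpM2l//; lra.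
  by rewrite -rt2; lra.
lra.
Qed.

Lemma lowtail_le w : w%:R <= lam -> g w <= 2 / rt.
Proof.
move=> wl; have r5 := rt_ge5; have [k [k1 k2]] := step_exists.
have rp : 0 < rt by lra.
rewrite ler_pdivlMr// -(ler_pM2l rp) (mulrC (g _)) mulrA rt2.
have [kw|wk] := leqP k w; last first.
  have : lam * g w <= w%:R.
    elim: w wl {wk} => [|w IH] wl; first by rewrite lowtail0 mulr0.
    have wl' : w%:R <= lam by apply: le_trans wl; rewrite ler_nat.
    rewrite lowtailS -natr1 lerD2r (le_trans _ (IH wl'))//.
    by rewrite ler_wpM2r// lowtail_ge0.
  have : w%:R <= k%:R :> R by rewrite ler_nat ltnW.
  lra.
move: wl; rewrite -(subnK kw); set v := (w - k)%N; rewrite natrD => wl.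
set G := g v.
have G0 : 0 <= G by exact: lowtail_ge0.
have key j : (j <= k)%N -> lam * (g (v + j)%N - G)
    <= j%:R - G * (j%:R * k%:R - j%:R * (j%:R - 1) / 2).
  elim: j => [|j IH] jk; first by rewrite addn0 /G; lra.
  have := IH (ltnW jk).
  have -> : j.+1%:R = j%:R + 1 :> R by rewrite natr1.
  have := lowtailS (v + j); rewrite addnS => E.
  have Gj : G <= g (v + j) by exact: lowtail_nd_add.
  have jkR : j%:R <= k%:R :> R by rewrite ler_nat ltnW.
  have : (k%:R - j%:R) * G <= (lam - (v + j)%:R) * g (v + j).
    by apply: ler_pM => //; rewrite ?natrD; lra.
  by lra.
have := key k (leqnn k) => K.
have HK : k%:R * G <= 1.
  apply: le_trans (lowtail_sub_le v); apply: ler_wpM2r => //; lra.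
have kk : 0 <= lam - k%:R * (k%:R + 1) / 2 by rewrite -rt2; nra.
have k0 : 0 < k%:R :> R by lra.
have L1 : lam * g (v + k)%N <= k%:R + G * (lam - k%:R * (k%:R + 1) / 2) by lra.
have L2 : G * (lam - k%:R * (k%:R + 1) / 2) <= rt - (k%:R + 1) / 2.
  rewrite -(ler_pM2l k0) mulrA (le_trans (ler_wpM2r kk HK))// mul1r.
  have : rt * rt <= rt * k%:R by rewrite ler_wpM2l//; lra.
  by rewrite -rt2; lra.
lra.
Qed.
End poisson_mass.

Section poisson_stein.
Context {R : realType}.
Variable lam : R.
Hypothesis lam0 : 0 < lam.
Notation pi := (@poisson_pmf R lam).
Notation F := (@poisson_cdf R lam).
Notation g := (@lowtail R lam).
Notation h := (@uptail R lam).

Definition poisson_part (A : pred nat) (w : nat) : R :=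
  \sum_(j < w) (A j)%:R * pi j.
Notation al := poisson_part.

Lemma poisson_partS A w : al A w.+1 = al A w + (A w)%:R * pi w.
Proof. by rewrite /al big_ord_recr. Qed.

Lemma poisson_part0 A : al A 0 = 0. Proof. by rewrite /al big_ord0. Qed.

Lemma poisson_part_ge0 A w : 0 <= al A w.
Proof. by apply: sumr_ge0 => j _; rewrite mulr_ge0// poisson_pmf_ge0. Qed.

Lemma poisson_part_le_cdf A w : al A w <= F w.
Proof.
by apply: ler_sum => j _; rewrite ler_piMl ?poisson_pmf_ge0// lern1 leq_b1.
Qed.

Section stein_solution.
Variables (A : pred nat) (PA : R).
Hypothesis PA_ge : forall w, al A w <= PA.
Hypothesis PA_le : forall w, PA - al A w <= 1 - F w.

Definition stein_sol (w : nat) : R := (al A w - PA * F w) / (w%:R * pi w).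
Notation f := stein_sol.

Let pi_gt0 k : 0 < pi k. Proof. exact: poisson_pmf_gt0. Qed.

Lemma stein_solE w : f w = h w * al A w - g w * (PA - al A w).
Proof. by rewrite /f /uptail /lowtail; ring. Qed.

Lemma stein_sol0 : f 0 = 0.
Proof. by rewrite /f mul0r invr0 mulr0. Qed.

Lemma stein_solS w : lam * f w.+1 - w%:R * f w = (A w)%:R - PA.
Proof.
have pN0 : pi w != 0 by exact: lt0r_neq0.
have lN0 : lam != 0 by exact: lt0r_neq0.
have -> : w%:R * f w = (al A w - PA * F w) / pi w.
  case: w pN0 => [|w] pN0; last first.
    rewrite /f; have : w.+1%:R != 0 :> R by rewrite pnatr_eq0.
    by move: (w.+1%:R : R) => a a0; field; rewrite pN0 a0.
  by rewrite mul0r poisson_part0 poisson_cdf0 mulr0 subrr mul0r.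
rewrite /f poisson_pmfS// poisson_partS poisson_cdfS; field.
by rewrite lN0 pN0.
Qed.

Lemma stein_sol_normr_le w : `|f w| <= g w * (1 - F w) /\ `|f w| <= h w * F w.
Proof.
have -> : h w * F w = g w * (1 - F w) by rewrite /uptail /lowtail; ring.
suff : `|f w| <= g w * (1 - F w) by [].
rewrite /f /lowtail mulrAC normrM (ger0_norm (_ : 0 <= (w%:R * pi w)^-1)); last first.
  by rewrite invr_ge0 mulr_ge0// ltW.
apply: ler_wpM2r; first by rewrite invr_ge0 mulr_ge0// ltW.
have F0 := poisson_cdf_ge0 lam w; have F1 := poisson_cdf_le1 lam lam0 w.
have := PA_ge w; have := PA_le w; have := poisson_part_ge0 A w.
have := poisson_part_le_cdf A w => a1 a2 a3 a4.
by rewrite ler_norml; apply/andP; split; nra.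
Qed.

Let gap_uptail w : (h w.+1 - h w) * F w <= (h w.+1 - h w) * al A w <= 0.
Proof.
case: w => [|w]; first by rewrite poisson_part0 poisson_cdf0 !mulr0 lexx.
have d0 : h w.+2 - h w.+1 <= 0 by rewrite subr_le0 uptail_ni.
by rewrite ler_wnM2l ?poisson_part_le_cdf// mulr_le0_ge0// poisson_part_ge0.
Qed.

Let stein_sol_diffE w : lam * (f w.+1 - f w) = lam * (h w.+1 - h w) * al A w
   - lam * (g w.+1 - g w) * (PA - al A w) + (A w)%:R.
Proof.
rewrite !stein_solE poisson_partS.
have := tailsE lam lam0 w => E.
rewrite -[X in _ = _ + X]mulr1 -E; ring.
Qed.

Let tails_balance w : lam * (h w.+1 - h w) * F w
  - lam * (g w.+1 - g w) * (1 - F w) + 1 = 0.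
Proof.
have E := tailsE lam lam0 w.
have E1 : h w.+1 * F w.+1 = g w.+1 * (1 - F w.+1) by rewrite /uptail /lowtail; ring.
have E2 : h w * F w = g w * (1 - F w) by rewrite /uptail /lowtail; ring.
move: E1; rewrite poisson_cdfS => E1; rewrite -[X in _ + X = _]E.
transitivity (lam * (h w.+1 * (F w + pi w) - g w.+1 * (1 - (F w + pi w)))
  - lam * (h w * F w - g w * (1 - F w))); first by ring.
by rewrite E1 E2; ring.
Qed.

Lemma stein_sol_diff_in w : A w -> 0 <= lam * (f w.+1 - f w) <= 1.
Proof.
move=> Aw; rewrite stein_sol_diffE Aw /=.
have := tails_balance w; have := lowtail_nd lam lam0 w.
rewrite -subr_ge0 => /(mulr_ge0 (ltW lam0)) v0.
have /andP[u1 u2] := gap_uptail w; have := PA_ge w; have := PA_le w.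
rewrite -(ler_pM2l lam0) !mulrA in u1; rewrite -(pmulr_rle0 _ lam0) mulrA in u2.
move: u1 u2 v0.
move: (lam * (h w.+1 - h w)) (lam * (g w.+1 - g w)) => u v u1 u2 v0 p1 p2 b.
by apply/andP; split; nra.
Qed.

Lemma stein_sol_diff_notin w : ~~ A w -> -1 <= lam * (f w.+1 - f w) <= 0.
Proof.
move=> /negbTE Aw; rewrite stein_sol_diffE Aw /=.
have := tails_balance w; have := lowtail_nd lam lam0 w.
rewrite -subr_ge0 => /(mulr_ge0 (ltW lam0)) v0.
have /andP[u1 u2] := gap_uptail w; have := PA_ge w; have := PA_le w.
rewrite -(ler_pM2l lam0) !mulrA in u1; rewrite -(pmulr_rle0 _ lam0) mulrA in u2.
move: u1 u2 v0.
move: (lam * (h w.+1 - h w)) (lam * (g w.+1 - g w)) => u v u1 u2 v0 p1 p2 b.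
by apply/andP; split; nra.
Qed.

Lemma stein_sol_diff_le w : `|f w.+1 - f w| <= lam^-1.
Proof.
rewrite -(ler_pM2l lam0) mulfV ?lt0r_neq0// -{1}(gtr0_norm lam0) -normrM.
have [Aw|Aw] := boolP (A w).
  have /andP[d0 d1] := stein_sol_diff_in w Aw.
  by rewrite ger0_norm.
have /andP[d0 d1] := stein_sol_diff_notin w Aw.
by rewrite ler0_norm// lerNl.
Qed.

Lemma stein_sol_le rt w : rt * rt = lam -> 5 <= rt -> `|f w| <= 2 / rt.
Proof.
move=> rt2 rt5; have [f1 f2] := stein_sol_normr_le w.
have F0 := poisson_cdf_ge0 lam w; have F1 := poisson_cdf_le1 lam lam0 w.
have [wl|lw] := lerP w%:R lam.
  apply: le_trans (lowtail_le lam lam0 rt rt2 rt5 w wl).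
  by rewrite (le_trans f1)// ler_piMr ?lowtail_ge0//; lra.
case: w lw f1 f2 F0 F1 => [|w] lw f1 f2 F0 F1; first by move: (lt_trans lam0 lw); rewrite ltxx.
apply: le_trans (uptail_le lam lam0 rt rt2 rt5 w (ltW lw)).
by rewrite (le_trans f2)// ler_piMr ?uptail_ge0.
Qed.
End stein_solution.

Section point.
Variable a : nat.

Lemma poisson_part_pred1 w : al (pred1 a) w = (a < w)%:R * pi a.
Proof.
elim: w => [|w IH]; first by rewrite poisson_part0 ltn0 mul0r.
rewrite poisson_partS IH /= [in RHS]ltnS [in RHS]leq_eqVlt (eq_sym w).
by have [<-|_] := eqVneq a w; rewrite ?ltnn ?mul0r ?add0r ?addr0.
Qed.

Lemma poisson_point_ge w : al (pred1 a) w <= pi a.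
Proof. by rewrite poisson_part_pred1 ler_piMl ?poisson_pmf_ge0// lern1 leq_b1. Qed.

Lemma poisson_point_le w : pi a - al (pred1 a) w <= 1 - F w.
Proof.
rewrite poisson_part_pred1; have [aw|wa] := ltnP a w.
  by rewrite mul1r subrr subr_ge0 poisson_cdf_le1.
rewrite mul0r subr0 lerBrDr (le_trans _ (poisson_cdf_le1 lam lam0 a.+1))//.
by rewrite poisson_cdfS addrC lerD2r poisson_cdf_nd.
Qed.

Notation f := (stein_sol (pred1 a) (pi a)).

Lemma stein_point_low w : (w <= a)%N -> f w = - (g w * pi a).
Proof.
move=> wa; rewrite stein_solE poisson_part_pred1 ltnNge wa /=.
by rewrite mul0r mulr0 subr0 sub0r.
Qed.

Lemma stein_point_up w : (a < w)%N -> f w = h w * pi a.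
Proof.
by move=> aw; rewrite stein_solE poisson_part_pred1 aw mul1r subrr mulr0 subr0.
Qed.

Let lpi : 0 < lam * pi a. Proof. by rewrite mulr_gt0// poisson_pmf_gt0. Qed.

Lemma stein_point_normr_le w : lam * `|f w| <= 1.
Proof.
have [wa|aw] := leqP w a.
  rewrite stein_point_low// normrN ger0_norm; last first.
    by rewrite mulr_ge0 ?lowtail_ge0// poisson_pmf_ge0.
  rewrite mulrCA mulrC (le_trans (y := lam * pi a * g a.+1))//.
    rewrite ler_pM2l// -(subnKC (leqW wa)).
    exact: lowtail_nd_add.
  by rewrite lowtailSE// poisson_cdf_le1.
rewrite stein_point_up// ger0_norm; last first.
  by rewrite mulr_ge0 ?uptail_ge0// poisson_pmf_ge0.
rewrite mulrCA mulrC (le_trans (y := lam * pi a * h a.+1))//.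
  rewrite ler_pM2l// -(subnKC aw).
  exact: uptail_ni_add.
by rewrite uptailSE// lerBlDr lerDl poisson_cdf_ge0.
Qed.

Lemma stein_point_sign w : if (w <= a)%N then f w <= 0 else 0 <= f w.
Proof.
have [wa|aw] := leqP w a.
  by rewrite stein_point_low// oppr_le0 mulr_ge0 ?lowtail_ge0// poisson_pmf_ge0.
by rewrite stein_point_up// mulr_ge0 ?uptail_ge0// poisson_pmf_ge0.
Qed.

Lemma stein_point_diff_a : 0 <= lam * (f a.+1 - f a) <= 1.
Proof.
apply: stein_sol_diff_in; [exact: poisson_point_ge|exact: poisson_point_le|].
by rewrite /= eqxx.
Qed.

Lemma stein_point_diff_neq w : w != a -> -1 <= lam * (f w.+1 - f w) <= 0.
Proof.
by move=> wa; apply: stein_sol_diff_notin; [exact: poisson_point_ge|exact: poisson_point_le|].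
Qed.

Lemma stein_point_diff_small w : w != a ->
  `|lam * (f w.+1 - f w)| <= pi a + `|a%:R - lam| / lam.
Proof.
move=> wa; have l0 := lam0; have /andP[_ d0] := stein_point_diff_neq w wa.
have := stein_solS (pred1 a) (pi a) w; rewrite /= (negbTE wa) /= => E.
rewrite ler0_norm// -(ler_pM2l lam0).
have -> : lam * (pi a + `|a%:R - lam| / lam) = lam * pi a + `|a%:R - lam|.
  by field; exact: lt0r_neq0.
have fl := stein_point_normr_le w; have := stein_point_sign w.
have aP : a%:R - lam <= `|a%:R - lam| by exact: ler_norm.
have aN : - `|a%:R - lam| <= a%:R - lam by rewrite lerNl -normrN ler_norm.
have -> : - (lam * (f w.+1 - f w)) = pi a + (lam - w%:R) * f w by lra.
have [wl|aw] := leqP w a => fs.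
  rewrite ler0_norm// in fl.
  have wR : w%:R <= a%:R :> R by rewrite ler_nat.
  suff : lam * ((lam - w%:R) * f w) <= `|a%:R - lam| by lra.
  have [x|x] := lerP w%:R lam.
    apply: le_trans (normr_ge0 _).
    by rewrite pmulr_rle0// mulr_ge0_le0// subr_ge0.
  have : (w%:R - lam) * (lam * - f w) <= (w%:R - lam) * 1.
    by rewrite ler_wpM2l// subr_ge0 ltW.
  lra.
rewrite ger0_norm// in fl.
have wR : a%:R <= w%:R :> R by rewrite ler_nat ltnW.
suff : lam * ((lam - w%:R) * f w) <= `|a%:R - lam| by lra.
have [x|x] := lerP lam w%:R.
  apply: le_trans (normr_ge0 _).
  by rewrite pmulr_rle0// mulr_le0_ge0// subr_le0.
have : (lam - w%:R) * (lam * f w) <= (lam - w%:R) * 1.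
  by rewrite ler_wpM2l// subr_ge0 ltW.
lra.
Qed.

Lemma stein_point_variation N :
  \sum_(w < N | val w != a) `|f w.+1 - f w| <= f a.+1 - f a.
Proof.
have fa0 := stein_point_sign a; rewrite leqnn in fa0.
have fS0 := stein_point_sign a.+1; rewrite ltnn in fS0.
rewrite (eq_bigr (fun w : 'I_N => - (f w.+1 - f w))); last first.
  move=> w wa; rewrite ler0_norm// -(pmulr_rle0 _ lam0).
  by have /andP[] := stein_point_diff_neq w wa.
have tele n : \sum_(w < n) (f w.+1 - f w) = f n.
  elim: n => [|n IH]; first by rewrite big_ord0 stein_sol0.
  by rewrite big_ord_recr /= IH addrC subrK.
rewrite sumrN; have [Na|aN] := leqP N a.
  rewrite (eq_bigl xpredT); last first.
    by move=> w; rewrite neq_ltn (leq_trans (ltn_ord w)).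
  rewrite tele; have := stein_point_low N Na; have := stein_point_low a (leqnn a).
  have := lowtail_nd_add lam lam0 N (a - N); rewrite subnKC// => gN.
  have : g N * pi a <= g a * pi a by rewrite ler_wpM2r// poisson_pmf_ge0.
  lra.
have := tele N; rewrite (bigD1 (Ordinal aN))//= => tN.
have := stein_point_sign N; rewrite leqNgt aN /= => fN.
rewrite (eq_bigl (fun w : 'I_N => w != Ordinal aN)); first lra.
by move=> w; rewrite -val_eqE.
Qed.
End point.

Lemma expR_ge_quad (x : R) : 0 <= x -> 1 + x + x ^+ 2 / 2 <= expR x.
Proof.
move=> x0; have nd : nondecreasing_seq (series (exp_coeff x)).
  apply: nondecreasing_series => n _ _.
  by rewrite /exp_coeff /= divr_ge0// exprn_ge0.
have := nondecreasing_cvgn_le nd (is_cvg_series_exp_coeff x) 3.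
rewrite /series /= !big_nat_recr//= big_geq// /exp_coeff /= add0r expr0 expr1.
by rewrite !divr1.
Qed.

(* The maximum over all rates [lam] of [lam * poisson_pmf lam k ^+ 2], attained at
   [lam = k + 1/2]; it decreases in [k], from [1 / (2 e) <= 81 / 400] at [k = 0]. *)
Let mode_mass (k : nat) : R :=
  (k%:R + 2^-1) ^+ k.*2.+1 * expR (- k.*2.+1%:R) / (k`!)%:R ^+ 2.

Let poisson_le_mode_mass k : lam * pi k ^+ 2 <= mode_mass k.
Proof.
have n0 : 0 < k%:R + 2^-1 :> R by rewrite ltr_wpDl.
have k0 : 0 < (k`!)%:R :> R by rewrite ltr0n fact_gt0.
rewrite /mode_mass /poisson_pmf lam0.
set n := k%:R + 2^-1; set E := expR (- lam).
have -> : lam * (lam ^+ k / k`!%:R * E) ^+ 2 = lam ^+ k.*2.+1 * E ^+ 2 / k`!%:R ^+ 2.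
  rewrite !exprMn exprVn -exprM muln2 [in RHS]exprS; ring.
rewrite ler_pM2r ?invr_gt0 ?exprn_gt0//.
rewrite -[leLHS](divfK (lt0r_neq0 (exprn_gt0 k.*2.+1 n0))) mulrC.
rewrite ler_pM2l ?exprn_gt0// mulrAC -expr_div_n.
have h : lam / n <= expR (lam / n - 1).
  by apply: le_trans (expR_ge1Dx _); rewrite addrC subrK.
apply: (@le_trans _ _ (expR (lam / n - 1) ^+ k.*2.+1 * E ^+ 2)).
  by rewrite ler_wpM2r ?exprn_ge0 ?expR_ge0// lerXn2r// nnegrE ?expR_ge0 ?divr_ge0 ?ltW.
rewrite /E -!expRM_natl -expRD ler_expR le_eqVlt; apply/orP; left; apply/eqP.
have -> : k.*2.+1%:R = 2 * n :> R by rewrite -natr1 -muln2 natrM /n; field.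
by field; exact: lt0r_neq0.
Qed.

Let mode_mass_ni k : mode_mass k.+1 <= mode_mass k.
Proof.
pose t : R := k.+1%:R; pose v := (2 * t)^-1.
have t1 : 1 <= t by rewrite ler1n.
have t0 : 0 < t by lra.
have tN : t != 0 by exact: lt0r_neq0.
have v0 : 0 <= v by rewrite invr_ge0; lra.
pose y1 := 1 + v; pose y2 := t / (t - 2^-1).
have h2 : 0 < t - 2^-1 by lra.
have h2N : t - 2^-1 != 0 by exact: lt0r_neq0.
have y2E : (1 - v) * y2 = 1.
  rewrite mulrA (_ : (1 - v) * t = t - 2^-1) ?divff//.
  by rewrite mulrBl mul1r /v invfM -mulrA mulVf// mulr1.
have bnd y : y <= expR (v + y * expR (- v) - 1).
  have := expR_ge1Dx (y * expR (- v) - 1); rewrite addrC subrK => h.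
  by rewrite -addrA expRD -ler_pdivrMl ?expR_gt0// -expRN mulrC.
have E0 : 0 < expR v by exact: expR_gt0.
have zE : expR (- v) * ((1 + v) ^+ 2 + 1) <= 2.
  rewrite expRN ler_pdivrMl//; have := expR_ge_quad v v0; rewrite !expr2; lra.
have vt : v * t = 2^-1 by rewrite /v; field.
have key : y1 ^+ k.*2.+3 * y2 ^+ k.*2.+1 <= expR 2.
  have y1_ge0 : 0 <= y1 by rewrite /y1; lra.
  have y2_ge0 : 0 <= y2 by rewrite divr_ge0// ltW.
  apply: le_trans.
    apply: (ler_pM (exprn_ge0 _ y1_ge0) (exprn_ge0 _ y2_ge0));
      by apply: lerXn2r; [rewrite nnegrE..|exact: bnd]; rewrite ?nnegrE ?expR_ge0.
  rewrite -!expRM_natl -expRD ler_expR.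
  have -> : k.*2.+3%:R = 2 * t * (1 + v) :> R.
    rewrite mulrDr mulr1 -mulrA (mulrC t) vt /t.
    by rewrite -[in LHS]muln2 -!natr1 natrM; field.
  have -> : k.*2.+1%:R = 2 * t * (1 - v) :> R.
    rewrite mulrBr mulr1 -mulrA (mulrC t) vt /t.
    by rewrite -[in LHS]muln2 -!natr1 natrM; field.
  set e := expR (- v) in zE *.
  have -> : 2 * t * (1 + v) * (v + y1 * e - 1) + 2 * t * (1 - v) * (v + y2 * e - 1)
    = 2 * t * (2 * v - 2 + ((1 + v) ^+ 2 + (1 - v) * y2) * e).
    by rewrite /y1; ring.
  rewrite y2E; have : 2 * t * (2 * v - 2 + ((1 + v) ^+ 2 + 1) * e) <= 2 * t * (2 * v).
    by rewrite ler_pM2l//; lra.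
  lra.
have tn : k.+1%:R + 2^-1 = y1 * t by rewrite /y1 mulrDl mul1r vt.
have kn : k%:R + 2^-1 = t - 2^-1 by rewrite /t -natr1; field.
have y2t : t = y2 * (t - 2^-1) by rewrite /y2 divfK.
rewrite /mode_mass factS natrM -/t tn kn.
have k0 : 0 < (k`!)%:R :> R by rewrite ltr0n fact_gt0.
have k2 : 0 < (k`!)%:R ^+ 2 :> R by rewrite exprn_gt0.
have t2 : 0 < t ^+ 2 by rewrite exprn_gt0.
rewrite [X in _ / X <= _]exprMn invfM mulrA ler_pM2r ?invr_gt0// ler_pdivrMr//.
rewrite doubleS (_ : - k.*2.+3%:R = - k.*2.+1%:R - 2); last first.
  by rewrite -!(natr1 _.+1) -!(natr1 k.*2) ; ring.
rewrite expRD (expRN 2) mulrA ler_pdivrMr ?expR_gt0//.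
rewrite -(mulrA _ (t ^+ 2)) [leRHS]mulrAC ler_pM2r ?expR_gt0//.
have -> : (y1 * t) ^+ k.*2.+3
    = y1 ^+ k.*2.+3 * y2 ^+ k.*2.+1 * ((t - 2^-1) ^+ k.*2.+1 * t ^+ 2).
  have tE : t ^+ k.*2.+3 = (y2 * (t - 2^-1)) ^+ k.*2.+1 * t ^+ 2.
    by rewrite -y2t -exprD addn2.
  by rewrite exprMn tE exprMn !mulrA.
rewrite [leRHS]mulrA [leRHS]mulrC ler_pM2r//.
by rewrite mulr_gt0// exprn_gt0.
Qed.

Lemma poisson_pmf_le_mode k : lam * pi k ^+ 2 <= 81 / 400.
Proof.
apply: (le_trans (poisson_le_mode_mass k)).
elim: k => [|k IH]; last exact: le_trans (mode_mass_ni k) IH.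
rewrite /mode_mass /= expr1 add0r expr1n divr1 expRN.
have := expR_ge_quad 1 ler01; rewrite expr1n => e.
have e0 : 0 < expR 1 :> R by lra.
by rewrite ler_pdivrMr//; lra.
Qed.
End poisson_stein.

Section poisson_sets.
Context {R : realType}.
Variable lam : R.
Hypothesis lam0 : 0 < lam.
Notation pi := (@poisson_pmf R lam).

Definition poisson_mass (A : pred nat) : R :=
  fine (\sum_(n <oo) ((A n)%:R * pi n)%:E)%E.

Let term_ge0 (A : pred nat) n : (0 <= ((A n)%:R * pi n)%:E :> \bar R)%E.
Proof. by rewrite lee_fin mulr_ge0// poisson_pmf_ge0. Qed.

Let mass_sumE (A : pred nat) :
  (\sum_(n <oo) ((A n)%:R * pi n)%:E = (poisson_mass A)%:E :> \bar R)%E.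
Proof.
rewrite /poisson_mass fineK// ge0_fin_numE; last by apply: nneseries_ge0.
apply: (@le_lt_trans _ _ 1%E); last exact: ltry.
rewrite -(esum_poisson_pmf lam lam0) -nneseries_esumT; last first.
  by move=> n; rewrite lee_fin poisson_pmf_ge0.
apply: lee_nneseries => n _ //.
by rewrite lee_fin ler_piMl ?poisson_pmf_ge0// lern1 leq_b1.
Qed.

Lemma poisson_part_le_mass A w : poisson_part lam A w <= poisson_mass A.
Proof.
rewrite -lee_fin -mass_sumE /poisson_part -sumEFin.
rewrite -(big_mkord xpredT (fun j => ((A j)%:R * pi j)%:E)).
by apply: nneseries_lim_ge => n _.
Qed.

Lemma poisson_massC A : poisson_mass A + poisson_mass (predC A) = 1.
Proof.
apply: EFin_inj; rewrite EFinD -!mass_sumE -nneseriesD//.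
rewrite -(esum_poisson_pmf lam lam0) -nneseries_esumT; last first.
  by move=> n; rewrite lee_fin poisson_pmf_ge0.
apply: eq_eseriesr => n _; rewrite -EFinD -mulrDl /=.
by case: (A n); rewrite ?addr0 ?add0r mul1r.
Qed.

Lemma poisson_mass_sub_part A w :
  poisson_mass A - poisson_part lam A w <= 1 - poisson_cdf lam w.
Proof.
have -> : poisson_cdf lam w = poisson_part lam A w + poisson_part lam (predC A) w.
  rewrite /poisson_cdf /poisson_part -big_split /=; apply: eq_bigr => j _.
  by rewrite -mulrDl; case: (A j); rewrite ?addr0 ?add0r mul1r.
have := poisson_massC A; have := poisson_part_le_mass (predC A) w; lra.
Qed.

Lemma poisson_mass_ge0 A : 0 <= poisson_mass A.
Proof. by have := poisson_part_le_mass A 0; rewrite poisson_part0. Qed.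

Lemma poisson_mass_le1 A : poisson_mass A <= 1.
Proof. by have := poisson_massC A; have := poisson_mass_ge0 (predC A); lra. Qed.

Lemma esum_poisson_mass (A : set nat) :
  (\esum_(n in A) (pi n)%:E = (poisson_mass (fun n => n \in A))%:E)%E.
Proof.
rewrite -mass_sumE esum_mkcond nneseries_esumT; last by move=> n; exact: term_ge0.
by apply: eq_esum => n _; case: ifP; rewrite ?mul1r ?mul0r.
Qed.
End poisson_sets.

Section translated_poisson.
Context {R : realType}.
Variables (mu sigma2 : R).
Hypothesis sigma20 : 0 < sigma2.

Definition TP_shift : int := Num.floor (mu - sigma2).
Definition TP_rate : R := sigma2 + (mu - sigma2 - TP_shift%:~R).

Lemma TP_frac_itv : 0 <= mu - sigma2 - TP_shift%:~R < 1.
Proof.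
rewrite /TP_shift; have := floor_le_tmp (mu - sigma2); have := floorD1_gt (mu - sigma2).
rewrite intrD => a b; apply/andP; split; lra.
Qed.

Lemma TP_rate_gt0 : 0 < TP_rate.
Proof. by rewrite /TP_rate; have /andP[] := TP_frac_itv; have := sigma20; lra. Qed.

Lemma TP_pmf_shift n : TP_pmf mu sigma2 (TP_shift + n%:Z) = poisson_pmf TP_rate n.
Proof.
rewrite /TP_pmf -/TP_shift lerDl le0z_nat.
by congr poisson_pmf; rewrite addrC addKr absz_nat.
Qed.

Lemma TP_pmf_lt k : k < TP_shift -> TP_pmf mu sigma2 k = 0.
Proof. by move=> ks; rewrite /TP_pmf -/TP_shift leNgt ks. Qed.

Lemma esum_TP_pmf (A : set int) :
  (\esum_(k in A) (TP_pmf mu sigma2 k)%:E =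
   (poisson_mass TP_rate (fun n => (TP_shift + n%:Z)%R \in A))%:E)%E.
Proof.
pose B := [set n : nat | A (TP_shift + n%:Z)].
transitivity (\esum_(k in A `&` [set k | (TP_shift <= k)%R]) (TP_pmf mu sigma2 k)%:E)%E.
  rewrite esum_mkcondr; apply: eq_esum => k Ak.
  case: ifPn => // /negP kn; rewrite TP_pmf_lt// ltNge.
  by apply/negP => h; apply: kn; rewrite inE.
rewrite (@reindex_esum _ _ _ B _ (fun n : nat => TP_shift + n%:Z)).
  rewrite (eq_esum (b := fun n => (poisson_pmf TP_rate n)%:E)).
    rewrite esum_poisson_mass ?TP_rate_gt0//.
  by move=> n _; rewrite TP_pmf_shift.
split.
- by move=> n /= Bn; split=> //=; rewrite lerDl.
- by move=> m n _ _ /addrI [].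
- move=> k [Ak /= sk]; exists `|k - TP_shift|%N; last first.
    by rewrite gez0_abs ?subr_ge0//; ring.
  rewrite /B /= gez0_abs ?subr_ge0//.
  by rewrite (_ : TP_shift + (k - TP_shift) = k)//; ring.
Qed.
End translated_poisson.

(** * Conditional laws and expectations *)

Section integer_variables.
Context {d : measure_display} {T : measurableType d}.

Lemma bigcup_int_preimage (X : T -> int) (A : set int) : X @^-1` A =
  \bigcup_n (if int_enum n \in A then X @^-1` [set int_enum n] else set0).
Proof.
apply/seteqP; split=> [x /= Ax|x [n _]].
  have [n nE] := int_enum_surj (X x); exists n => //.
  by rewrite nE mem_set.
by case: ifPn => [|//]; rewrite inE => An /= ->.
Qed.

Lemma measurable_preimage_int (X : T -> int) :
  (forall k, measurable (X @^-1` [set k])) -> forall A, measurable (X @^-1` A).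
Proof.
move=> mX A; rewrite bigcup_int_preimage; apply: bigcupT_measurable => n.
by case: ifP.
Qed.

Lemma measurable_fun_int {R : realType} (X : T -> int) (g : int -> R) :
  (forall k, measurable (X @^-1` [set k])) -> measurable_fun setT (g \o X).
Proof.
move=> mX _ B mB; rewrite setTI comp_preimage; exact: measurable_preimage_int.
Qed.

Lemma measurable_int_fiber {R : realType} (X : T -> int) :
  measurable_fun setT (fun x => (X x)%:~R : R) ->
  forall k, measurable (X @^-1` [set k]).
Proof.
move=> mX k; rewrite (_ : X @^-1` _ = (fun x => (X x)%:~R : R) @^-1` [set k%:~R]).
  by rewrite -[X in measurable X]setTI; apply: mX.
by apply/seteqP; split=> x /= => [->//|/intr_inj].
Qed.

Lemma integral_int_partition {R : realType} (mu : {measure set T -> \bar R})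
    (X : T -> int) (f : T -> \bar R) :
  (forall k, measurable (X @^-1` [set k])) ->
  measurable_fun setT f -> (forall x, 0 <= f x)%E ->
  (\int[mu]_x f x = \sum_(n <oo) \int[mu]_(x in X @^-1` [set int_enum n]) f x)%E.
Proof.
move=> mX mf f0; rewrite -ge0_integral_bigcup//; last first.
- move=> i j _ _ [x [/= Xi Xj]]; apply: int_enum_inj.
  by rewrite -Xi -Xj.
- exact: measurable_funTS.
congr (integral _ _ _); apply/seteqP; split=> // x _.
by have [n nE] := int_enum_surj (X x); exists n.
Qed.
End integer_variables.

Section pull_out.
Context {d : measure_display} {T : measurableType d} {R : realType}.
Variable P : probability T R.
Variable F : set (set T).
Hypothesis sF : sub_sigma F.
Notation TF := (g_sigma_algebraType F).

Lemma F_measurable_gT (X : T -> R) :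
  F_measurable F X -> measurable_fun setT (X : TF -> R).
Proof.
move=> FX _ B mB; rewrite setTI measurable_g_measurableTypeE; last exact: sF.1.
exact: FX.
Qed.

Lemma measurable_gT (A : set T) : measurable (A : set TF) -> F A.
Proof. by rewrite measurable_g_measurableTypeE//; exact: sF.1. Qed.

Lemma measurable_fun_gT d' (U : measurableType d') (X : T -> U) :
  measurable_fun setT (X : TF -> U) -> measurable_fun setT X.
Proof.
move=> mX _ B mB; rewrite setTI; apply: sF.2; apply: measurable_gT.
by rewrite -[X @^-1` B]setTI; exact: mX.
Qed.

Import HBNNSimple.

Lemma integral_pull_out (X Y : T -> R) (Z : T -> R) :
  measurable_fun setT X -> measurable_fun setT Y ->
  (forall x, 0 <= X x) -> (forall x, 0 <= Y x) ->
  (forall A, F A -> \int[P]_(x in A) (X x)%:E = \int[P]_(x in A) (Y x)%:E)%E ->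
  measurable_fun setT (Z : TF -> R) -> (forall x, 0 <= Z x) ->
  (\int[P]_x (Z x * X x)%:E = \int[P]_x (Z x * Y x)%:E)%E.
Proof.
move=> mX mY X0 Y0 XY mZ Z0.
have mEZ : measurable_fun (setT : set TF) (EFin \o (Z : TF -> R)) by exact/measurable_EFinP.
pose h := nnsfun_approx measurableT mEZ.
have mh n : measurable_fun (setT : set T) (h n : T -> R).
  by apply: measurable_fun_gT; exact: measurable_funP.
have approx (V : T -> R) : measurable_fun setT V -> (forall x, 0 <= V x) ->
    (\int[P]_x (Z x * V x)%:E = limn (fun n => \int[P]_x (h n x * V x)%:E))%E.
  move=> mV V0.
  have fE x : (Z x * V x)%:E = lim ((fun n => (h n x * V x)%:E) @ \oo).
    apply/esym/cvg_lim => //; under eq_fun do rewrite EFinM.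
    rewrite EFinM; apply: cvgeZr => //.
    by apply: (@cvg_nnsfun_approx _ _ _ _ measurableT _ mEZ) => // y _; rewrite lee_fin.
  under eq_integral do rewrite fE.
  apply: monotone_convergence => //.
  - by move=> n; apply/measurable_EFinP; exact: measurable_funM.
  - by move=> n x _; rewrite lee_fin mulr_ge0.
  - move=> x _ a b ab; rewrite lee_fin ler_wpM2r//.
    by have /lefP := @nd_nnsfun_approx _ _ _ _ measurableT _ mEZ _ _ ab.
rewrite (approx X)// (approx Y)//; apply/congr_lim/funext => n.
have simple (V : T -> R) : measurable_fun setT V -> (forall x, 0 <= V x) ->
    (\int[P]_x (h n x * V x)%:E =
     (\sum_(y \in range (h n)) (y%:E * \int[P]_(x in h n @^-1` [set y]) (V x)%:E))%E)%E.
  move=> mV V0.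
  have mpre y : measurable (h n @^-1` [set y] : set T).
    by rewrite -[X in measurable X]setTI; exact: mh.
  transitivity (\int[P]_x (\sum_(y \in range (h n))
      (y * \1_(h n @^-1` [set y]) x * V x)%:E)%E)%E.
    apply: eq_integral => x _; rewrite fsumEFin//; congr EFin.
    by rewrite -mulr_fsuml -fimfunE.
  rewrite ge0_integral_fsum//; last 2 first.
  - move=> y; apply/measurable_EFinP; apply: measurable_funM => //.
    exact: measurable_funM.
  - move=> y x _; rewrite lee_fin; have := nnfun_muleindic_ge0 (h n) y x.
    by rewrite lee_fin => ?; exact: mulr_ge0.
  apply: eq_fsbigr => y /set_mem[z _ zy].
  have y0 : 0 <= y by rewrite -zy.
  under eq_integral do rewrite -mulrA EFinM.
  rewrite ge0_integralZl//.
  - congr (_ * _)%E; rewrite [RHS]integral_mkcond; apply: eq_integral => x _.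
    by rewrite /patch indicE; case: ifP; rewrite ?mul1r ?mul0r.
  - by apply/measurable_EFinP; exact: measurable_funM.
  - by move=> x _; rewrite lee_fin mulr_ge0.
rewrite (simple X)// (simple Y)//; apply: eq_fsbigr => y _.
congr (_ * _)%E; apply: XY; apply: measurable_gT.
by rewrite -[X in measurable X]setTI; exact: measurable_funP.
Qed.

Lemma integral_cond_law (W : T -> int) (p : int -> T -> R) (H : T -> int -> R) :
  (forall k, measurable (W @^-1` [set k])) ->
  cond_law_version P F W p ->
  (forall k, measurable_fun setT (H ^~ k : TF -> R)) ->
  (forall x k, 0 <= H x k) ->
  (\int[P]_x (H x (W x))%:E = \int[P]_x \esum_(k in [set: int]) (H x k * p k x)%:E)%E.
Proof.
move=> mW [condp p01] mH H0.
have mHT k : measurable_fun setT (H ^~ k) by exact: measurable_fun_gT.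
have mp k : measurable_fun setT (p k).
  by have [_ _ /measurable_int/measurable_EFinP] := condp k.
have mHW : measurable_fun setT (fun x => H x (W x)).
  move=> _ B mB; rewrite setTI.
  have -> : (fun x => H x (W x)) @^-1` B = \bigcup_n (W @^-1` [set int_enum n]
      `&` (H ^~ (int_enum n)) @^-1` B).
    apply/seteqP; split=> [x /= Bx|x [n _ /= [-> //]]].
    by have [n nE] := int_enum_surj (W x); exists n => //=; rewrite nE.
  apply: bigcupT_measurable => n; apply: measurableI => //.
  by rewrite -[X in measurable X]setTI; exact: mHT.
rewrite (integral_int_partition P W)//; last 2 first.
- exact/measurable_EFinP.
- by move=> x; rewrite lee_fin.
transitivity (\sum_(n <oo) \int[P]_x (H x (int_enum n) * p (int_enum n) x)%:E)%E.
  apply: eq_eseriesr => n _.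
  rewrite -(integral_pull_out (\1_(W @^-1` [set int_enum n])))//; last 2 first.
  - by move=> x; exact: (p01 x).1.
  - by move=> A FA; have [_ _ _ ->] := condp (int_enum n).
  rewrite integral_mkcond; apply: eq_integral => x _.
  rewrite /patch indicE; case: ifPn => [|_]; last by rewrite mulr0.
  by rewrite inE /= => ->; rewrite mulr1.
rewrite -integral_nneseries//; last 2 first.
- by move=> n; apply/measurable_EFinP; exact: measurable_funM.
- by move=> n x _; rewrite lee_fin mulr_ge0// (p01 x).1.
apply: eq_integral => x _; rewrite esum_int// => k.
by rewrite lee_fin mulr_ge0// (p01 x).1.
Qed.
End pull_out.

Section real_expectations.
Context {d : measure_display} {T : measurableType d} {R : realType}.
Variable P : probability T R.
Implicit Types X Y : T -> R.
Notation Int X := (P.-integrable setT (EFin \o X)).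
Notation Ex X := (\int[P]_x X x).

Lemma Int_measurable X : Int X -> measurable_fun setT X.
Proof. by move=> /measurable_int/measurable_EFinP. Qed.

Lemma Int_cst (c : R) : Int (fun=> c).
Proof. exact: finite_measure_integrable_cst. Qed.

Lemma IntD X Y : Int X -> Int Y -> Int (fun x => X x + Y x).
Proof. by move=> iX iY; exact: (integrableD measurableT iX iY). Qed.

Lemma IntB X Y : Int X -> Int Y -> Int (fun x => X x - Y x).
Proof. by move=> iX iY; exact: (integrableB measurableT iX iY). Qed.

Lemma IntZ c X : Int X -> Int (fun x => c * X x).
Proof. by move=> iX; exact: (integrableZl measurableT c iX). Qed.

Lemma Int_norm X : Int X -> Int (fun x => `|X x|).
Proof. by move=> iX; exact: integrable_norm. Qed.

Lemma Int_dom X Y : measurable_fun setT X -> (forall x, `|X x| <= Y x) ->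
  Int Y -> Int X.
Proof.
move=> mX XY; apply: le_integrable => //; first exact/measurable_EFinP.
by move=> x _ /=; rewrite lee_fin (le_trans (XY x))// ler_norm.
Qed.

Lemma Int_bounded X (B : R) : measurable_fun setT X -> (forall x, `|X x| <= B) ->
  Int X.
Proof. by move=> mX XB; exact: Int_dom mX XB (Int_cst B). Qed.

Lemma Int_mul_bounded X Y (B : R) : Int X -> measurable_fun setT Y ->
  (forall x, `|Y x| <= B) -> Int (fun x => X x * Y x).
Proof.
move=> iX mY YB; apply: (Int_dom _ (fun x => B * `|X x|)).
- by apply: measurable_funM => //; exact: Int_measurable.
- by move=> x; rewrite normrM mulrC ler_wpM2r.
- exact/IntZ/Int_norm.
Qed.

Lemma Ex_cst c : Ex (fun=> c) = c.
Proof. by rewrite Rintegral_cst//= probability_setT mulr1. Qed.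

Lemma Ex_le X Y : Int X -> Int Y -> (forall x, X x <= Y x) -> Ex X <= Ex Y.
Proof. by move=> iX iY XY; apply: le_Rintegral. Qed.

Lemma Ex_EFin X : Int X -> ((Ex X)%:E = \int[P]_x (X x)%:E)%E.
Proof. by move=> iX; rewrite /Rintegral fineK//; exact: integrable_fin_num. Qed.

Lemma normr_Ex_le X : Int X -> `|Ex X| <= Ex (fun x => `|X x|).
Proof. by move=> iX; exact: le_normr_Rintegral. Qed.

Lemma Int_ge0 X (c : R) : measurable_fun setT X -> (forall x, 0 <= X x) ->
  (\int[P]_x (X x)%:E <= c%:E)%E -> Int X.
Proof.
move=> mX X0 Xc; apply/integrableP; split; first exact/measurable_EFinP.
under eq_integral do rewrite /= ger0_norm//.
exact: le_lt_trans Xc (ltry _).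
Qed.

Lemma Int_mul_sqr X Y : measurable_fun setT X -> measurable_fun setT Y ->
  Int (fun x => X x ^+ 2) -> Int (fun x => Y x ^+ 2) -> Int (fun x => X x * Y x).
Proof.
move=> mX mY iX iY; apply: (Int_dom _ (fun x => X x ^+ 2 + Y x ^+ 2)).
- exact: measurable_funM.
- move=> x; have := sqr_ge0 (X x + Y x); have := sqr_ge0 (X x - Y x).
  have := sqr_ge0 (X x); have := sqr_ge0 (Y x).
  by rewrite ler_norml !expr2; nra.
- exact: IntD.
Qed.

Lemma Ex_mul_sqr_le X Y (a b : R) : measurable_fun setT X -> measurable_fun setT Y ->
  Int (fun x => X x ^+ 2) -> Int (fun x => Y x ^+ 2) ->
  0 < a -> 0 < b -> Ex (fun x => X x ^+ 2) <= a ^+ 2 ->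
  Ex (fun x => Y x ^+ 2) <= b ^+ 2 -> Ex (fun x => `|X x * Y x|) <= a * b.
Proof.
move=> mX mY iX iY a0 b0 Xa Yb.
have iXY := Int_mul_sqr X Y mX mY iX iY.
apply: (@le_trans _ _ (Ex (fun x => b / (2 * a) * X x ^+ 2 + a / (2 * b) * Y x ^+ 2))).
  apply: Ex_le; [exact: Int_norm|by apply: IntD; exact: IntZ|] => x.
  have : 0 <= (b * X x - a * Y x) ^+ 2 /\ 0 <= (b * X x + a * Y x) ^+ 2.
    by rewrite !sqr_ge0.
  have ab0 : 0 < 2 * a * b by rewrite !mulr_gt0.
  move=> [h1 h2]; rewrite -(ler_pM2l ab0).
  have -> : 2 * a * b * (b / (2 * a) * X x ^+ 2 + a / (2 * b) * Y x ^+ 2) =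
    b ^+ 2 * X x ^+ 2 + a ^+ 2 * Y x ^+ 2.
    by field; rewrite !lt0r_neq0.
  rewrite -{1}(gtr0_norm ab0) -normrM ler_norml.
  by apply/andP; split; move: h1 h2; rewrite !sqrrD ?sqrrN !exprMn; lra.
rewrite RintegralD//; [|exact: IntZ..].
rewrite !RintegralZl//.
have c1 : 0 < b / (2 * a) by rewrite divr_gt0// mulr_gt0.
have c2 : 0 < a / (2 * b) by rewrite divr_gt0// mulr_gt0.
have -> : a * b = b / (2 * a) * a ^+ 2 + a / (2 * b) * b ^+ 2.
  by field; rewrite !lt0r_neq0.
by apply: lerD; rewrite ler_pM2l.
Qed.

Lemma Lnorm2_le X (c : R) : measurable_fun setT X -> 0 <= c ->
  ('N[P]_2%:E[EFin \o X] <= c%:E)%E ->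
  Int (fun x => X x ^+ 2) /\ Ex (fun x => X x ^+ 2) <= c ^+ 2.
Proof.
move=> mX c0 Nc.
have I2 : (\int[P]_x (X x ^+ 2)%:E <= (c ^+ 2)%:E)%E.
  have -> : (\int[P]_x (X x ^+ 2)%:E = 'N[P]_2%:E[EFin \o X] `^ 2)%E.
    rewrite poweR_Lnorm//; apply: eq_integral => x _.
    rewrite -[RHS]/(`|X x|%:E `^ 2)%E poweR_EFin powR_mulrn// -normrX.
    by rewrite ger0_norm ?sqr_ge0.
  have := Lnorm_ge0 P 2%:E (EFin \o X).
  case: ('N[P]_2%:E[EFin \o X])%E Nc => [r| |]//.
  rewrite !lee_fin => rc r0.
  by rewrite powR_mulrn// lerXn2r// nnegrE.
have iX : Int (fun x => X x ^+ 2).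
  by apply: Int_ge0 I2; [exact: measurable_funX|move=> x; exact: sqr_ge0].
by split=> //; rewrite -lee_fin Ex_EFin.
Qed.
End real_expectations.

Section nonmeasurable_majorant.
Context {d : measure_display} {T : measurableType d} {R : realType}.
Variable mu : {measure set T -> \bar R}.

(* No measurability is required: the integral of a nonnegative function is a
   supremum over the simple functions below it. *)
Lemma ge0_le_integral_any (f g : T -> \bar R) : (forall x, 0 <= f x)%E ->
  (forall x, f x <= g x)%E -> (\int[mu]_x f x <= \int[mu]_x g x)%E.
Proof.
move=> f0 fg; have g0 x : (0 <= g x)%E by exact: le_trans (fg x).
rewrite !ge0_integralTE//; apply: le_ereal_sup => _ [h hf <-].
by exists h => // x; exact: le_trans (hf x) (fg x).
Qed.
End nonmeasurable_majorant.

Section discrete_expectations.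
Context {d : measure_display} {T : measurableType d} {R : realType}.
Variable P : probability T R.
Variable W : T -> int.
Hypothesis mW : forall k, measurable (W @^-1` [set k]).
Notation Int X := (P.-integrable setT (EFin \o X)).

Let W_cover : \bigcup_n W @^-1` [set int_enum n] = setT.
Proof.
apply/seteqP; split=> // x _.
by have [n nE] := int_enum_surj (W x); exists n.
Qed.

Let W_triv : trivIset setT (fun n => W @^-1` [set int_enum n]).
Proof.
move=> i j _ _ [x [/= Xi Xj]]; apply: int_enum_inj.
by rewrite -Xi -Xj.
Qed.

Lemma Ex_mul_fiberwise (X Y : T -> R) (psi : int -> R) (B : R) :
  Int X -> Int Y -> (forall k, `|psi k| <= B) ->
  (forall k, \int[P]_(x in W @^-1` [set k]) (X x)%:E
    = \int[P]_(x in W @^-1` [set k]) (Y x)%:E)%E ->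
  \int[P]_x (X x * psi (W x)) = \int[P]_x (Y x * psi (W x)).
Proof.
move=> iX iY psiB XY.
have mpsi : measurable_fun setT (psi \o W) by exact: measurable_fun_int.
have expand (Z : T -> R) : Int Z -> (\int[P]_x (Z x * psi (W x))%:E =
    \sum_(n <oo) ((psi (int_enum n))%:E *
      \int[P]_(x in W @^-1` [set int_enum n]) (Z x)%:E))%E.
  move=> iZ; have iZp := Int_mul_bounded P _ _ B iZ mpsi (fun x => psiB (W x)).
  rewrite -{1}W_cover integral_bigcup ?W_cover//.
  apply: eq_eseriesr => n _; rewrite -integralZl//; last first.
    exact: (integrableS measurableT).
  by apply: eq_integral => x; rewrite inE /= => ->; rewrite mulrC EFinM.
rewrite /Rintegral expand// expand//; congr fine; apply: eq_eseriesr => n _.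
by rewrite XY.
Qed.

Lemma integral_discrete_le (phi : int -> R) (M S : R) :
  (forall k, 0 <= phi k) -> 0 <= M -> (forall k, P (W @^-1` [set k]) <= M%:E)%E ->
  (\sum_(n <oo) (phi (int_enum n))%:E <= S%:E)%E ->
  (\int[P]_x (phi (W x))%:E <= (M * S)%:E)%E.
Proof.
move=> phi0 M0 PM phiS.
rewrite (integral_int_partition P W)//; last 2 first.
- by apply/measurable_EFinP; exact: (measurable_fun_int W phi).
- by move=> x; rewrite lee_fin.
apply: (@le_trans _ _ (\sum_(n <oo) M%:E * (phi (int_enum n))%:E)%E).
  apply: lee_nneseries => [n _ _|n _].
    by apply: integral_ge0 => x _; rewrite lee_fin.
  rewrite (eq_integral (cst (phi (int_enum n))%:E)); last first.
    by move=> x; rewrite inE /= => ->.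
  by rewrite integral_cst// muleC; apply: lee_wpmul2r; [rewrite lee_fin|exact: PM].
rewrite nneseriesZl; last by move=> n _; rewrite lee_fin.
by rewrite EFinM; apply: lee_wpmul2l; rewrite ?lee_fin.
Qed.
End discrete_expectations.

Section taylor_remainder.
Context {d : measure_display} {T : measurableType d} {R : realType}.
Variable P : probability T R.
Variables (W : T -> int) (F : set (set T)) (G : T -> R) (Dz : T -> int).
Variable p : int -> T -> R.
Hypothesis sF : sub_sigma F.
Hypothesis mW : forall k, measurable (W @^-1` [set k]).
Hypothesis FG : F_measurable F G.
Hypothesis FD : F_measurable F (fun x => (Dz x)%:~R : R).
Hypothesis lawp : cond_law_version P F W p.
Notation Int X := (P.-integrable setT (EFin \o X)).
Notation TF := (g_sigma_algebraType F).

Lemma measurable_taylor2 (f : int -> R) k :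
  measurable_fun setT ((fun x => G x * taylor2 f (Dz x) k) : TF -> R).
Proof.
apply: measurable_funM; first exact: F_measurable_gT.
apply: (@measurable_fun_int _ TF _ Dz (taylor2 f ^~ k)).
apply: measurable_int_fiber; exact: F_measurable_gT FD.
Qed.

Lemma summable_cond_law x : summable [set: int] (EFin \o (p ^~ x)).
Proof.
have [_ /(_ x)[p0 p1]] := lawp.
rewrite /summable (eq_esum (b := fun k => (p k x)%:E)); first by rewrite p1 ltry.
by move=> k _; rewrite /= ger0_norm.
Qed.

Lemma sumZ_cond_taylor2_le (f : int -> R) (B : R) x : (forall k, `|f k| <= B) ->
  (`|sumZ (fun k => G x * taylor2 f (Dz x) k * p k x)%R|
   <= (B / 2)%:E * (`|G x * (Dz x)%:~R * ((Dz x)%:~R - 1)|%:E * S2 (p ^~ x)))%E.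
Proof.
move=> fB; have [_ /(_ x)[p0 p1]] := lawp.
have sp := summable_cond_law x.
have B0 : 0 <= B by exact: le_trans (fB 0).
rewrite (eq_sumZ _ (fun k => G x * (taylor2 f (Dz x) k * p k x))); last first.
  by move=> k; rewrite mulrA.
rewrite sumZZ; last first.
  by apply: (summable_bounded _ p0 sp _ _ (taylor2_bounded _ _ fB (Dz x))).
rewrite abseM; apply: le_trans.
  apply: lee_wpmul2l; first by rewrite abse_ge0.
  exact: (sumZ_taylor2_le _ p0 sp _ _ fB (Dz x)).
rewrite !muleA -!EFinM lee_wpmul2r ?S2_ge0// lee_fin -!mulrA !normrM.
by rewrite le_eqVlt; apply/orP; left; apply/eqP; ring.
Qed.

Lemma taylor_remainder_le (f : int -> R) (B U : R) : 0 < B ->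
  (forall k, `|f k| <= B) ->
  Int (fun x => G x * taylor2 f (Dz x) (W x)) ->
  (\int[P]_x (`|G x * (Dz x)%:~R * ((Dz x)%:~R - 1)|%:E * S2 (p ^~ x)) <= U%:E)%E ->
  `|\int[P]_x (G x * taylor2 f (Dz x) (W x))| <= B / 2 * U.
Proof.
move=> B0 fB iH UH; have [_ p01] := lawp.
pose H x k := G x * taylor2 f (Dz x) k.
pose Hp x k : R := Num.max (H x k) 0; pose Hn x k : R := Num.max (- H x k) 0.
have mH k : measurable_fun setT (H ^~ k : TF -> R) by exact: measurable_taylor2.
have mHp k : measurable_fun setT (Hp ^~ k : TF -> R).
  by apply: measurable_maxr => //.
have mHn k : measurable_fun setT (Hn ^~ k : TF -> R).
  by apply: measurable_maxr => //; exact: measurableT_comp.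
have Hp0 x k : 0 <= Hp x k by rewrite le_max lexx orbT.
have Hn0 x k : 0 <= Hn x k by rewrite le_max lexx orbT.
have p0 k x : 0 <= p k x by exact: (p01 x).1.
pose Sp x := (\esum_(k in [set: int]) (Hp x k * p k x)%:E)%E.
pose Sn x := (\esum_(k in [set: int]) (Hn x k * p k x)%:E)%E.
have HE x k : H x k = Hp x k - Hn x k.
  rewrite /Hp /Hn; have [h|h] := lerP 0 (H x k).
    by rewrite max_r ?oppr_le0// subr0.
  by rewrite max_l ?oppr_ge0 ?(ltW h)// sub0r opprK.
have Habs x k : Hp x k <= `|H x k| /\ Hn x k <= `|H x k|.
  by rewrite /Hp /Hn !ge_max normr_ge0 ler_norm lerNl -normrN -lerNl ler_norm.
have intp := integral_cond_law P F sF W p Hp mW lawp mHp Hp0.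
have intn := integral_cond_law P F sF W p Hn mW lawp mHn Hn0.
have mHW : measurable_fun setT (fun x => H x (W x)) by exact: Int_measurable iH.
have iHp : Int (fun x => Hp x (W x)).
  apply: (Int_dom P _ (fun x => `|H x (W x)|)); last exact: Int_norm.
    by apply: measurable_maxr => //.
  by move=> x; rewrite ger0_norm//; exact: (Habs x (W x)).1.
have iHn : Int (fun x => Hn x (W x)).
  apply: (Int_dom P _ (fun x => `|H x (W x)|)); last exact: Int_norm.
    by apply: measurable_maxr => //; exact: measurableT_comp.
  by move=> x; rewrite ger0_norm//; exact: (Habs x (W x)).2.
have mS (K : T -> int -> R) : (forall k, measurable_fun setT (K ^~ k : TF -> R)) ->
    (forall x k, 0 <= K x k) ->
    measurable_fun setT (fun x => \esum_(k in [set: int]) (K x k * p k x)%:E)%E.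
  move=> mK K0.
  rewrite (_ : (fun x => _) = (fun x => \sum_(n <oo) (K x (int_enum n) * p (int_enum n) x)%:E)%E).
    apply: ge0_emeasurable_sum => [n x _ _|n _]; first by rewrite lee_fin mulr_ge0.
    apply/measurable_EFinP; apply: measurable_funM.
      exact: (measurable_fun_gT _ sF _ _ _ (mK (int_enum n))).
    have [cp _] := lawp; have [_ _ ip _] := cp (int_enum n).
    exact: Int_measurable ip.
  by apply/funext => x; rewrite esum_int// => k; rewrite lee_fin mulr_ge0.
have mSp : measurable_fun setT Sp by exact: mS.
have mSn : measurable_fun setT Sn by exact: mS.
have Sp0 x : (0 <= Sp x)%E by apply: esum_ge0 => k _; rewrite lee_fin mulr_ge0.
have Sn0 x : (0 <= Sn x)%E by apply: esum_ge0 => k _; rewrite lee_fin mulr_ge0.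
have iSp : P.-integrable setT Sp.
  apply/integrableP; split=> //; under eq_integral do rewrite gee0_abs//.
  by rewrite -intp -(Ex_EFin P)// ltry.
have iSn : P.-integrable setT Sn.
  apply/integrableP; split=> //; under eq_integral do rewrite gee0_abs//.
  by rewrite -intn -(Ex_EFin P)// ltry.
have SE x : (Sp x - Sn x)%E = sumZ (fun k => H x k * p k x).
  rewrite /sumZ; congr (_ - _)%E; apply: eq_esum => k _; congr EFin.
    by rewrite maxr_pMl ?p0// mul0r.
  by rewrite -mulNr -[X in Num.max _ X](mul0r (p k x)) -maxr_pMl ?p0.
have intS : (\int[P]_x (H x (W x)))%:E = (\int[P]_x (Sp x - Sn x))%E.
  have -> : \int[P]_x (H x (W x)) = \int[P]_x (Hp x (W x) - Hn x (W x)).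
    by apply: eq_Rintegral => x _; exact: HE.
  by rewrite RintegralB// EFinB !Ex_EFin// intp intn integralB.
rewrite -lee_fin (_ : (`|_|)%:E = `|\int[P]_x (Sp x - Sn x)|)%E; last by rewrite -intS.
apply: (le_trans (le_abse_integral _ _ _)) => //.
  exact: measurable_int (integrableB measurableT iSp iSn).
have mabs : measurable_fun setT (fun x => `|Sp x - Sn x|)%E.
  by apply: measurableT_comp => //; exact: measurable_int (integrableB measurableT iSp iSn).
have B2 : 0 < B / 2 by rewrite divr_gt0.
apply: (@le_trans _ _ ((B / 2)%:E * \int[P]_x ((B / 2)^-1%:E * `|Sp x - Sn x|))%E).
  rewrite ge0_integralZl//; last by rewrite lee_fin invr_ge0 ltW.
  by rewrite muleA -EFinM mulfV ?lt0r_neq0// mul1e.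
rewrite (EFinM _ U); apply: lee_wpmul2l; first by rewrite lee_fin ltW.
apply: le_trans UH; apply: ge0_le_integral_any => x.
  by rewrite mule_ge0// lee_fin invr_ge0 ltW.
rewrite SE lee_pdivrMl//; exact: sumZ_cond_taylor2_le.
Qed.
End taylor_remainder.

(** * Consequences of the coupling *)

Section coupling.
Context {d : measure_display} {T : measurableType d} {R : realType}.
Variable P : probability T R.
Variables (W Wp : T -> int) (G Rr : T -> R) (mu sigma : R).
Variables (F1 F2 : set (set T)) (pW : int -> T -> R) (cGD : T -> R) (c1 : R).
Notation Int X := (P.-integrable setT (EFin \o X)).
Notation Wr x := ((W x)%:~R : R).
Notation D x := ((Wp x - W x)%:~R : R).

Hypothesis mWr : measurable_fun setT (fun x => Wr x).
Hypothesis mWpr : measurable_fun setT (fun x => (Wp x)%:~R : R).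
Hypothesis mG : measurable_fun setT G.
Hypothesis mR : measurable_fun setT Rr.
Hypothesis coupling : forall f : int -> R,
  Int (fun x => (Wr x - mu) * f (W x)) ->
  Int (fun x => G x * (f (Wp x) - f (W x))) ->
  Int (fun x => Rr x * f (W x)) ->
  (\int[P]_x ((Wr x - mu) * f (W x))%:E
    = \int[P]_x (G x * (f (Wp x) - f (W x)))%:E + \int[P]_x (Rr x * f (W x))%:E)%E.
Hypothesis iW : Int (fun x => Wr x).
Hypothesis EW : (\int[P]_x (Wr x)%:E = mu%:E)%E.
Hypothesis sigma0 : 0 < sigma.
Hypothesis VW : (\int[P]_x ((Wr x - mu) ^+ 2)%:E = (sigma ^+ 2)%:E)%E.
Hypotheses (sF1 : sub_sigma F1) (sF2 : sub_sigma F2).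
Hypothesis F1W : F_measurable F1 (fun x => Wr x).
Hypothesis F2G : F_measurable F2 G.
Hypothesis F2D : F_measurable F2 (fun x => D x).
Hypothesis lawW : cond_law_version P F2 W pW.
Hypothesis condGD : cond_exp_version P F1 (fun x => G x * D x) cGD.
Hypothesis Ups_le : (\int[P]_x (`|G x * D x * (D x - 1)|%:E * S2 (pW ^~ x)) + 1 <= c1%:E)%E.
Hypothesis R_le : ('N[P]_2%:E[EFin \o Rr] <= c1%:E)%E.

Definition mean_GD : R := \int[P]_x (G x * D x).
Notation m := mean_GD.

Let fiberW := measurable_int_fiber W mWr.
Let fiberWp := measurable_int_fiber Wp mWpr.

Let mfW (f : int -> R) : measurable_fun setT (fun x => f (W x)).
Proof. exact: (measurable_fun_int W f fiberW). Qed.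

Let mfWp (f : int -> R) : measurable_fun setT (fun x => f (Wp x)).
Proof. exact: (measurable_fun_int Wp f fiberWp). Qed.

Lemma coupling_c1_ge1 : 1 <= c1.
Proof.
have := Ups_le; have : (0 <= \int[P]_x (`|G x * D x * (D x - 1)|%:E * S2 (pW ^~ x)))%E.
  apply: integral_ge0 => x _; apply: mule_ge0; first by rewrite lee_fin.
  by apply: S2_ge0; exact: (summable_cond_law P W F2 pW lawW).
case: (\int[P]_x _)%E => [r| |]//; rewrite -EFinD !lee_fin; lra.
Qed.
Let c1_gt0 : 0 < c1. Proof. by apply: lt_le_trans coupling_c1_ge1. Qed.

Lemma centered_integrable : Int (fun x => Wr x - mu).
Proof. exact: IntB iW (Int_cst P mu). Qed.

Lemma centered_mean : \int[P]_x (Wr x - mu) = 0.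
Proof.
rewrite RintegralB//; last exact: Int_cst.
by rewrite Ex_cst /Rintegral EW subrr.
Qed.

Lemma centered_sqr_integrable : Int (fun x => (Wr x - mu) ^+ 2).
Proof.
apply: (@Int_ge0 _ _ _ P _ (sigma ^+ 2)); last by rewrite VW.
  by apply: measurable_funX; exact: Int_measurable centered_integrable.
by move=> x; exact: sqr_ge0.
Qed.

Lemma variance_real : \int[P]_x ((Wr x - mu) ^+ 2) = sigma ^+ 2.
Proof. by rewrite /Rintegral VW. Qed.

Let R2 := Lnorm2_le P Rr c1 mR (ltW c1_gt0) R_le.

Let one2 : Int (fun=> (1 : R) ^+ 2) /\ \int[P]_x ((1 : R) ^+ 2) <= 1 ^+ 2.
Proof. by split; [exact: Int_cst|rewrite Ex_cst]. Qed.

Let mc : measurable_fun setT (fun x => Wr x - mu).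
Proof. exact: Int_measurable centered_integrable. Qed.

Let iR : Int Rr.
Proof.
have := Int_mul_sqr P Rr (fun=> 1) mR (measurable_cst _) R2.1 one2.1.
by under [X in EFin \o X]eq_fun do rewrite mulr1.
Qed.

Let ER_le : \int[P]_x `|Rr x| <= c1.
Proof.
have := Ex_mul_sqr_le P Rr (fun=> 1) c1 1 mR (measurable_cst _) R2.1 one2.1 c1_gt0
  ltr01 R2.2 one2.2.
by rewrite mulr1; under eq_Rintegral do rewrite mulr1.
Qed.

Let iGD : Int (fun x => G x * D x).
Proof. by have [] := condGD. Qed.

Let icGD : Int cGD.
Proof. by have [] := condGD. Qed.

Lemma coupling_real (f : int -> R) :
  Int (fun x => (Wr x - mu) * f (W x)) ->
  Int (fun x => G x * (f (Wp x) - f (W x))) ->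
  Int (fun x => Rr x * f (W x)) ->
  \int[P]_x ((Wr x - mu) * f (W x))
    = \int[P]_x (G x * (f (Wp x) - f (W x))) + \int[P]_x (Rr x * f (W x)).
Proof.
move=> i1 i2 i3; apply: EFin_inj.
by rewrite EFinD !Ex_EFin// coupling.
Qed.

Lemma mean_remainder0 : \int[P]_x Rr x = 0.
Proof.
have e1 : (fun x => (Wr x - mu) * 1) = (fun x => Wr x - mu).
  by apply/funext => x; rewrite mulr1.
have e2 : (fun x => G x * (1 - 1)) = (fun=> 0).
  by apply/funext => x; rewrite subrr mulr0.
have e3 : (fun x => Rr x * 1) = Rr by apply/funext => x; rewrite mulr1.
have := coupling_real (fun=> 1); rewrite e1 e2 e3 centered_mean Ex_cst add0r.
by move=> /(_ centered_integrable (Int_cst P 0) iR) <-.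
Qed.

Let iRc : Int (fun x => Rr x * (Wr x - mu)).
Proof. exact: Int_mul_sqr mR mc R2.1 centered_sqr_integrable. Qed.

Lemma mean_GD_close : `|sigma ^+ 2 - m| <= sigma * c1.
Proof.
have i1 : Int (fun x => (Wr x - mu) * Wr x).
  rewrite (_ : (fun x => _) = (fun x => (Wr x - mu) ^+ 2 + mu * (Wr x - mu))).
    exact: IntD centered_sqr_integrable (IntZ _ mu _ centered_integrable).
  by apply/funext => x; ring.
have i3E : (fun x => Rr x * Wr x) = (fun x => Rr x * (Wr x - mu) + mu * Rr x).
  by apply/funext => x; ring.
have i3 : Int (fun x => Rr x * Wr x).
  by rewrite i3E; exact: IntD iRc (IntZ _ mu _ iR).
have e2 : (fun x => G x * ((Wp x)%:~R - Wr x)) = (fun x => G x * D x).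
  by apply/funext => x; rewrite intrB.
have := coupling_real (fun k => k%:~R) i1; rewrite e2 => /(_ iGD i3).
rewrite i3E RintegralD//; last exact: IntZ.
rewrite RintegralZl// mean_remainder0 mulr0 addr0.
have -> : \int[P]_x ((Wr x - mu) * Wr x) = sigma ^+ 2.
  rewrite (_ : (fun x => (Wr x - mu) * Wr x) = (fun x => (Wr x - mu) ^+ 2 + mu * (Wr x - mu))).
    rewrite RintegralD//; [|exact: centered_sqr_integrable|exact/IntZ/centered_integrable].
    rewrite RintegralZl//; last exact: centered_integrable.
    by rewrite centered_mean mulr0 addr0 variance_real.
  by apply/funext => x; ring.
move=> ->; rewrite -/m addrC addKr (le_trans (normr_Ex_le _ _ iRc))// mulrC.
apply: Ex_mul_sqr_le => //; [exact: R2.1|exact: centered_sqr_integrable|exact: R2.2|].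
by rewrite variance_real.
Qed.

Lemma cond_GD_mul (psi : int -> R) (B : R) : (forall k, `|psi k| <= B) ->
  \int[P]_x (G x * D x * psi (W x)) = \int[P]_x (cGD x * psi (W x)).
Proof.
move=> psiB; apply: (Ex_mul_fiberwise P W fiberW _ _ psi B) => // k.
have [_ _ _ ->//] := condGD.
rewrite (_ : W @^-1` [set k] = (fun x => Wr x) @^-1` [set k%:~R]); first exact: F1W.
by apply/seteqP; split=> x /= => [->//|/intr_inj].
Qed.

Section test_function.
Variables (f : int -> R) (B gam : R).
Hypotheses (B0 : 0 < B) (fB : forall k, `|f k| <= B) (gam0 : 0 <= gam).
Notation Df k := (f (k + 1) - f k).

Let DfB k : `|Df k| <= 2 * B.
Proof. by have := fB k; have := fB (k + 1); rewrite !ler_norml; lra. Qed.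

Let iDf : Int (fun x => Df (W x)).
Proof.
by apply: (Int_bounded P _ (2 * B)) => [|x]; [exact: (mfW (fun k => Df k))|exact: DfB].
Qed.

Let iGf : Int (fun x => G x * (f (Wp x) - f (W x))).
Proof.
apply: (Int_dom P _ (fun x => 2 * B * `|G x * D x|)); last exact/IntZ/Int_norm.
  by apply: measurable_funM => //; apply: measurable_funB.
move=> x; rewrite !normrM mulrCA ler_wpM2l//.
have [->|WpW] := eqVneq (Wp x) (W x); first by rewrite !subrr normr0 mulr_ge0// mulr_ge0// ltW.
have : `|f (Wp x) - f (W x)| <= 2 * B.
  by have := fB (Wp x); have := fB (W x); rewrite !ler_norml; lra.
move=> h; apply: (le_trans h); apply: ler_peMr; first by rewrite mulr_ge0// ltW.
by rewrite -intr_norm -[leLHS]/(1%:~R) ler_int -gtz0_ge1 normr_gt0 subr_eq0.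
Qed.

Let iRf : Int (fun x => Rr x * f (W x)).
Proof. by apply: (Int_mul_bounded P _ _ B) => //; exact: mfW. Qed.

Let iGDDf : Int (fun x => G x * D x * Df (W x)).
Proof. by apply: (Int_mul_bounded P _ _ (2 * B)) => //; exact: (mfW (fun k => Df k)). Qed.

Lemma stein_coupling_bound :
  `|\int[P]_x ((sigma ^+ 2 + gam) * Df (W x) - (Wr x - mu) * f (W x))|
   <= (sigma * c1 + gam) * `|\int[P]_x Df (W x)|
      + \int[P]_x (`|cGD x - m| * `|Df (W x)|) + ((c1 - 1) / 2 + c1) * B.
Proof.
have icf : Int (fun x => (Wr x - mu) * f (W x)).
  exact: (Int_mul_bounded P _ _ B centered_integrable (mfW f) (fun x => fB (W x))).
have icDf : Int (fun x => cGD x * Df (W x)).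
  by apply: (Int_mul_bounded P _ _ (2 * B)) => //; exact: (mfW (fun k => Df k)).
have icm : Int (fun x => cGD x - m) by exact: IntB icGD (Int_cst P m).
have iT : Int (fun x => (cGD x - m) * Df (W x)).
  by apply: (Int_mul_bounded P _ _ (2 * B)) => //; exact: (mfW (fun k => Df k)).
pose H x := G x * taylor2 f (Wp x - W x) (W x).
have HE x : H x = G x * (f (Wp x) - f (W x)) - G x * D x * Df (W x).
  by rewrite /H /taylor2 (_ : W x + (Wp x - W x) = Wp x); ring.
have iH : Int H.
  rewrite (_ : H = fun x => G x * (f (Wp x) - f (W x)) - G x * D x * Df (W x)).
    exact: IntB.
  by apply/funext => x; rewrite HE.
have remH : `|\int[P]_x H x| <= B / 2 * (c1 - 1).
  apply: (taylor_remainder_le P W F2 G (fun x => Wp x - W x) pW) => //.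
  have := Ups_le; case: (\int[P]_x _)%E => [r| |]//; last by move=> _; rewrite leNye.
  by rewrite -EFinD !lee_fin; lra.
have EH : \int[P]_x (G x * (f (Wp x) - f (W x))) =
    \int[P]_x H x + \int[P]_x (cGD x * Df (W x)).
  rewrite -(cond_GD_mul (fun k => Df k) _ DfB) -RintegralD//.
  by apply: eq_Rintegral => x _; rewrite HE subrK.
have ET : \int[P]_x (cGD x * Df (W x)) = m * \int[P]_x Df (W x)
    + \int[P]_x ((cGD x - m) * Df (W x)).
  rewrite -RintegralZl// -RintegralD//; last exact: IntZ.
  by apply: eq_Rintegral => x _; ring.
have -> : \int[P]_x ((sigma ^+ 2 + gam) * Df (W x) - (Wr x - mu) * f (W x)) =
    (sigma ^+ 2 + gam) * \int[P]_x Df (W x) - \int[P]_x ((Wr x - mu) * f (W x)).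
  by rewrite -RintegralZl// -RintegralB//; exact: IntZ.
rewrite coupling_real// EH ET.
set a := \int[P]_x Df (W x) in ET *.
have b1 : `|\int[P]_x ((cGD x - m) * Df (W x))| <= \int[P]_x (`|cGD x - m| * `|Df (W x)|).
  rewrite (le_trans (normr_Ex_le _ _ iT))//.
  by under eq_Rintegral do rewrite normrM.
have b2 : `|\int[P]_x (Rr x * f (W x))| <= c1 * B.
  apply: (le_trans (normr_Ex_le _ _ iRf)).
  apply: (@le_trans _ _ (\int[P]_x (B * `|Rr x|))).
    apply: Ex_le; [exact: Int_norm|exact/IntZ/Int_norm|] => x.
    by rewrite normrM mulrC ler_wpM2r.
  rewrite RintegralZl//; last exact: Int_norm.
  by rewrite mulrC ler_wpM2r// ltW.
have b3 : `|(sigma ^+ 2 - m + gam) * a| <= (sigma * c1 + gam) * `|a|.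
  rewrite normrM ler_wpM2r// (le_trans (ler_normD _ _))// lerD ?mean_GD_close//.
  by rewrite ger0_norm.
move: remH b1 b2 b3; set h := \int[P]_x H x; set t := \int[P]_x ((cGD x - m) * _).
set r := \int[P]_x (Rr x * _); set tt := \int[P]_x (`|_| * _).
have -> : (sigma ^+ 2 + gam) * a - (h + (m * a + t) + r) =
  (sigma ^+ 2 - m + gam) * a - h - t - r by ring.
move: ((sigma ^+ 2 - m + gam) * a) ((sigma * c1 + gam) * `|a|) => u v.
by rewrite !ler_norml; lra.
Qed.
End test_function.

Lemma chebyshev_W (A : set int) (e : R) : 0 < e ->
  (forall k, A k -> e ^+ 2 <= (k%:~R - mu) ^+ 2) ->
  (P (W @^-1` A) <= (sigma ^+ 2 / e ^+ 2)%:E)%E.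
Proof.
move=> e0 Ae; have mA := measurable_preimage_int W fiberW A.
have e2 : 0 < e ^+ 2 by rewrite exprn_gt0.
rewrite -[leLHS]mul1e -integral_cst// EFinM -VW muleC.
rewrite -ge0_integralZl//; last 3 first.
- by apply/measurable_EFinP; exact: Int_measurable centered_sqr_integrable.
- by move=> x _; rewrite lee_fin sqr_ge0.
- by rewrite lee_fin invr_ge0 ltW.
rewrite integral_mkcond; apply: ge0_le_integral_any => x.
  by rewrite /patch; case: ifP => //; rewrite lee_fin.
rewrite /patch; case: ifPn => [|_]; last first.
  by rewrite -EFinM lee_fin mulr_ge0 ?sqr_ge0// invr_ge0 ltW.
rewrite inE /= => /Ae h.
by rewrite -EFinM lee_fin mulrC ler_pdivlMr// mul1r.
Qed.
End coupling.

(** * Total variation and local bounds *)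

Section shifted_functions.
Context {R : realType}.
Variable s : int.
Implicit Types f : nat -> R.

Definition shift_fun f (k : int) : R := if s <= k then f `|k - s|%N else 0.

Lemma int_shiftP k : k < s \/ exists n : nat, k = s + n%:Z.
Proof.
have [ks|sk] := ltP k s; [by left|right; exists `|k - s|%N].
by rewrite gez0_abs ?subr_ge0//; ring.
Qed.

Lemma shift_fun_add f n : shift_fun f (s + n%:Z) = f n.
Proof. by rewrite /shift_fun lerDl /= addrC addKr. Qed.

Lemma shift_fun_lt f k : k < s -> shift_fun f k = 0.
Proof. by move=> ks; rewrite /shift_fun leNgt ks. Qed.

Lemma shift_fun_normr_le f (B : R) : 0 <= B -> (forall n, `|f n| <= B) ->
  forall k, `|shift_fun f k| <= B.
Proof.
move=> B0 fB k; have [ks|[n ->]] := int_shiftP k.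
  by rewrite shift_fun_lt// normr0.
by rewrite shift_fun_add.
Qed.

Lemma shift_fun_diff f : f 0 = 0 -> (fun k => shift_fun f (k + 1) - shift_fun f k)
  = shift_fun (fun n => f n.+1 - f n).
Proof.
move=> f0; apply/funext => k; have [ks|[n ->]] := int_shiftP k.
  rewrite !(shift_fun_lt _ _ ks) subr0; have := ks; rewrite -lez1D addrC le_eqVlt.
  move=> /predU1P[->|k1]; last by rewrite shift_fun_lt.
  by have := shift_fun_add f 0; rewrite addr0 f0.
by rewrite (_ : s + n%:Z + 1 = s + n.+1%:Z) ?shift_fun_add//; lia.
Qed.

Lemma sum_shift_fun (phi : nat -> R) : (forall n, 0 <= phi n) ->
  (\sum_(n <oo) (shift_fun phi (int_enum n))%:E = \sum_(n <oo) (phi n)%:E)%E.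
Proof.
move=> phi0; have sphi0 k : 0 <= shift_fun phi k.
  by have [ks|[n ->]] := int_shiftP k; [rewrite shift_fun_lt|rewrite shift_fun_add].
rewrite -(esum_int (fun k => (shift_fun phi k)%:E)) => [|k]; last by rewrite lee_fin.
rewrite nneseries_esumT => [|n]; last by rewrite lee_fin.
transitivity (\esum_(k in [set: int] `&` [set k | (s <= k)%R]) (shift_fun phi k)%:E)%E.
  rewrite esum_mkcondr; apply: eq_esum => k _.
  case: ifPn => // /negP kn; rewrite shift_fun_lt// ltNge.
  by apply/negP => h; apply: kn; rewrite inE.
rewrite (@reindex_esum _ _ _ [set: nat] _ (fun n : nat => s + n%:Z)).
  by apply: eq_esum => n _; rewrite shift_fun_add.
split.
- by move=> n _ /=; rewrite lerDl.
- by move=> m n _ _ /addrI [].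
- by move=> k [_ /= sk]; have [|[n ->]] := int_shiftP k; [rewrite ltNge sk|exists n].
Qed.
End shifted_functions.

Section hoelder_moments.
Context {d : measure_display} {T : measurableType d} {R : realType}.
Variable P : probability T R.

Lemma hoelder_moment_le (X Y : T -> R) (p p' K L : R) :
  measurable_fun setT X -> measurable_fun setT Y ->
  0 < p -> 0 < p' -> p^-1 + p'^-1 = 1 -> 0 <= L ->
  ('N[P]_p%:E[EFin \o X] <= K%:E)%E ->
  (\int[P]_x (`|Y x| `^ p')%:E <= L%:E)%E ->
  (\int[P]_x (`|X x * Y x|)%:E <= (K * L `^ p'^-1)%:E)%E.
Proof.
move=> mX mY p0 p'0 pp' L0 XK YL.
have := hoelder P mX mY p0 p'0 pp'; rewrite Lnorm1 => h; apply: (le_trans h).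
rewrite EFinM; apply: lee_pmul => //; [exact: Lnorm_ge0|exact: Lnorm_ge0|].
rewrite unlock -poweR_EFin; apply: gt0_ler_poweR => //.
- by rewrite invr_ge0 ltW.
- by rewrite in_itv /= leey andbT; apply: integral_ge0 => x _; rewrite lee_fin powR_ge0.
- by rewrite in_itv /= leey andbT lee_fin.
Qed.
End hoelder_moments.

Section from_core_bound.
Context {d : measure_display} {T : measurableType d} {R : realType}.
Variable P : probability T R.
Variables (W : T -> int) (mu sigma c1 : R) (Tv : T -> R).
Notation Int X := (P.-integrable setT (EFin \o X)).
Notation Wr x := ((W x)%:~R : R).
Hypothesis fiberW : forall k, measurable (W @^-1` [set k]).
Hypothesis sigma0 : 0 < sigma.
Hypothesis c1_ge1 : 1 <= c1.
Hypothesis Tv0 : forall x, 0 <= Tv x.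
Hypothesis iTv : Int Tv.
Hypothesis core : forall (f : int -> R) (B gam : R), 0 < B ->
  (forall k, `|f k| <= B) -> 0 <= gam ->
  `|\int[P]_x ((sigma ^+ 2 + gam) * (f (W x + 1) - f (W x)) - (Wr x - mu) * f (W x))|
   <= (sigma * c1 + gam) * `|\int[P]_x (f (W x + 1) - f (W x))|
      + \int[P]_x (Tv x * `|f (W x + 1) - f (W x)|) + ((c1 - 1) / 2 + c1) * B.
Hypothesis cheb : forall (A : set int) (e : R), 0 < e ->
  (forall k, A k -> e ^+ 2 <= (k%:~R - mu) ^+ 2) ->
  (P (W @^-1` A) <= (sigma ^+ 2 / e ^+ 2)%:E)%E.

Notation s := (TP_shift mu (sigma ^+ 2)).
Notation lam := (TP_rate mu (sigma ^+ 2)).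
Definition prob_of (A : set int) : R := fine (P (W @^-1` A)).
Notation pr := prob_of.

Let mfW (f : int -> R) : measurable_fun setT (fun x => f (W x)).
Proof. exact: (measurable_fun_int W f fiberW). Qed.
Let mA A : measurable (W @^-1` A).
Proof. exact: measurable_preimage_int. Qed.
Let sigma2_gt0 : 0 < sigma ^+ 2. Proof. by rewrite exprn_gt0. Qed.
Let lam0 : 0 < lam. Proof. exact: TP_rate_gt0. Qed.
Let lamE : lam = mu - s%:~R. Proof. by rewrite /TP_rate; ring. Qed.
Let gam_itv : 0 <= lam - sigma ^+ 2 < 1.
Proof.
by have := TP_frac_itv mu (sigma ^+ 2); rewrite /TP_rate (_ : sigma ^+ 2 + _ - _ = mu - sigma ^+ 2 - s%:~R); [|ring].
Qed.
Let lam_ge : sigma ^+ 2 <= lam.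
Proof. by rewrite -subr_ge0; have /andP[] := gam_itv. Qed.

Lemma EFin_prob_of A : (pr A)%:E = P (W @^-1` A).
Proof. by rewrite /pr fineK// fin_num_measure. Qed.

Lemma prob_of_ge0 A : 0 <= pr A.
Proof. by rewrite fine_ge0. Qed.

Lemma prob_of_le1 A : pr A <= 1.
Proof. by rewrite -lee_fin EFin_prob_of probability_le1. Qed.

Lemma Ex_indic_W (A : set int) : \int[P]_x (W x \in A)%:R = pr A.
Proof.
rewrite /Rintegral (_ : (fun x => (W x \in A)%:R%:E) = EFin \o \1_(W @^-1` A)).
  by rewrite integral_indic// setIT.
by apply/funext => x /=; rewrite indicE; congr (nat_of_bool _)%:R%:E; apply/idP/idP; rewrite !inE.
Qed.

Let int_indic (A : set int) : Int (fun x => (W x \in A)%:R).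
Proof.
by apply: (Int_bounded P _ 1) => [|x]; [exact: (mfW (fun k => (k \in A)%:R))|case: (_ \in _); rewrite ?normr0 ?normr1].
Qed.

Lemma low_tail_le : pr [set k | (k < s)%R] <= (sigma ^+ 2)^-1.
Proof.
rewrite -lee_fin EFin_prob_of; apply: (le_trans (cheb _ _ sigma2_gt0 _)) => [k /= ks|].
  have k1 : k%:~R + 1 <= s%:~R :> R by rewrite -(intrD _ k 1) ler_int addrC lez1D.
  have sE : s%:~R = mu - lam by rewrite lamE; ring.
  rewrite -sqrrN lerXn2r// ?nnegrE; move: lam_ge sigma2_gt0; lra.
rewrite lee_fin [X in _ / X]expr2 invfM mulrA mulfV ?mul1r//.
exact: lt0r_neq0.
Qed.

Section stein_identity.
Variables (A : set int).
Let An : pred nat := fun n => s + n%:Z \in A.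
Let PA := poisson_mass lam An.
Definition stein_test : int -> R := shift_fun s (stein_sol lam An PA).
Notation f := stein_test.

Lemma stein_test_diffE k : f (k + 1) - f k =
  shift_fun s (fun n => stein_sol lam An PA n.+1 - stein_sol lam An PA n) k.
Proof. by rewrite -shift_fun_diff ?stein_sol0. Qed.

Lemma stein_test_eq k : lam * (f (k + 1) - f k) - (k%:~R - mu) * f k =
  if s <= k then (k \in A)%:R - PA else 0.
Proof.
rewrite stein_test_diffE /f; have [ks|[n ->]] := int_shiftP s k.
  by rewrite !shift_fun_lt// leNgt ks /= !mulr0 subrr.
rewrite !shift_fun_add lerDl /= -/(An n) -(stein_solS lam lam0 An PA n) intrD.
have -> : s%:~R + n%:~R - mu = n%:R - lam by rewrite lamE -pmulrn; ring.
by ring.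
Qed.

Let L := [set k : int | (k < s)%R].

Lemma stein_test_identity :
  \int[P]_x (lam * (f (W x + 1) - f (W x)) - (Wr x - mu) * f (W x)) =
    pr A - pr (A `&` L) - PA * (1 - pr L).
Proof.
transitivity (\int[P]_x (((W x \in A)%:R - (W x \in A `&` L)%:R)
       - PA * (1 - (W x \in L)%:R))).
  apply: eq_Rintegral => x _; rewrite stein_test_eq in_setI.
  have -> : (W x \in L) = (W x < s) by apply/idP/idP; rewrite inE.
  by rewrite leNgt; case: (W x < s); rewrite /= ?andbT ?andbF ?subrr ?mulr0 ?subr0 ?mulr1.
rewrite RintegralB//; last 2 first.
- exact: IntB.
- by apply/IntZ/IntB => //; exact: Int_cst.
rewrite RintegralB// RintegralZl//; last by apply: IntB => //; exact: Int_cst.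
by rewrite RintegralB ?Ex_cst ?Ex_indic_W//; exact: Int_cst.
Qed.

Let PA0 : 0 <= PA. Proof. exact: poisson_mass_ge0. Qed.
Let PA1 : PA <= 1. Proof. exact: poisson_mass_le1. Qed.

Lemma stein_test_error :
  `|pr A - PA| <= `|\int[P]_x (lam * (f (W x + 1) - f (W x)) - (Wr x - mu) * f (W x))|
    + (sigma ^+ 2)^-1.
Proof.
have p0 := PA0; have p1 := PA1; have L0 := prob_of_ge0 L.
have Ls : pr L <= (sigma ^+ 2)^-1 by exact: low_tail_le.
have AL0 := prob_of_ge0 (A `&` L).
have ALL : pr (A `&` L) <= pr L.
  by rewrite -lee_fin !EFin_prob_of le_measure ?inE//; move=> x [].
have -> : pr A - PA = (pr A - pr (A `&` L) - PA * (1 - pr L)) + (pr (A `&` L) - PA * pr L).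
  by ring.
rewrite stein_test_identity (le_trans (ler_normD _ _))// lerD2l.
by rewrite ler_norml; apply/andP; split; nra.
Qed.

Lemma stein_test_error_above : (forall k, A k -> s <= k) ->
  `|pr A - PA| <= `|\int[P]_x (lam * (f (W x + 1) - f (W x)) - (Wr x - mu) * f (W x))|
    + PA * (sigma ^+ 2)^-1.
Proof.
move=> As; have L0 := prob_of_ge0 L.
have Ls : pr L <= (sigma ^+ 2)^-1 by exact: low_tail_le.
have AL0 : pr (A `&` L) = 0.
  rewrite (_ : A `&` L = set0) ?/pr ?preimage_set0 ?measure0//.
  by apply/seteqP; split=> // k [/As sk]; rewrite /L /= ltNge sk.
have -> : pr A - PA = (pr A - pr (A `&` L) - PA * (1 - pr L)) - PA * pr L.
  by rewrite AL0; ring.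
rewrite stein_test_identity (le_trans (ler_normB _ _))// lerD2l.
by rewrite ger0_norm ?mulr_ge0// ler_wpM2l.
Qed.
End stein_identity.

Let test_core (A : set int) (B : R) (f := stein_test A) : 0 < B ->
  (forall k, `|f k| <= B) ->
  `|\int[P]_x (lam * (f (W x + 1) - f (W x)) - (Wr x - mu) * f (W x))|
   <= (sigma * c1 + 1) * `|\int[P]_x (f (W x + 1) - f (W x))|
      + \int[P]_x (Tv x * `|f (W x + 1) - f (W x)|) + ((c1 - 1) / 2 + c1) * B.
Proof.
move=> B0 fB; have /andP[g0 g1] := gam_itv.
have := core f B _ B0 fB g0.
have -> : sigma ^+ 2 + (lam - sigma ^+ 2) = lam by ring.
move=> h; apply: (le_trans h); rewrite !lerD2r ler_wpM2r// lerD2l; exact: ltW.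
Qed.

Let test_diff_le (A : set int) k (f := stein_test A) : `|f (k + 1) - f k| <= (sigma ^+ 2)^-1.
Proof.
have i0 : 0 <= (sigma ^+ 2)^-1 by rewrite invr_ge0 ltW.
rewrite stein_test_diffE.
apply: shift_fun_normr_le => // n.
apply: le_trans (stein_sol_diff_le lam lam0 _ _ _ _ n) _.
- exact: poisson_part_le_mass.
- exact: poisson_mass_sub_part.
- by rewrite lef_pV2 ?posrE.
Qed.

Let int_test_diff (A : set int) (f := stein_test A) : Int (fun x => f (W x + 1) - f (W x)).
Proof.
apply: (Int_bounded P _ (sigma ^+ 2)^-1) => [|x]; last exact: test_diff_le.
exact: (mfW (fun k => f (k + 1) - f k)).
Qed.

Lemma dTV_bound (A : set int) : 5 <= sigma -> \int[P]_x Tv x <= sigma * c1 ->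
  `|pr A - poisson_mass lam (fun n => (s + n%:Z)%R \in A)| <= 5 * c1 / sigma.
Proof.
move=> s5 ETv; set PA := poisson_mass _ _; pose f := stein_test A.
pose rt := Num.sqrt lam; have rt2 : rt * rt = lam by rewrite -expr2 sqr_sqrtr// ltW.
have rts : sigma <= rt.
  by rewrite -(ger0_norm (ltW sigma0)) -sqrtr_sqr ler_sqrt// ltW.
have rt5 : 5 <= rt by exact: le_trans rts.
have j0 : 0 < sigma^-1 by rewrite invr_gt0.
have B0 : 0 < 2 / sigma by rewrite divr_gt0.
have fB k : `|f k| <= 2 / sigma.
  apply: shift_fun_normr_le => [|n]; first exact: ltW.
  apply: le_trans (stein_sol_le lam lam0 _ _ _ _ rt n rt2 rt5) _.
  - exact: poisson_part_le_mass.
  - exact: poisson_mass_sub_part.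
  - by rewrite ler_pM2l// lef_pV2 ?posrE//; exact: lt_le_trans rts.
have iE : (sigma ^+ 2)^-1 = sigma^-1 ^+ 2 by rewrite exprVn.
have b1 : `|\int[P]_x (f (W x + 1) - f (W x))| <= sigma^-1 ^+ 2.
  rewrite (le_trans (normr_Ex_le _ _ (int_test_diff A)))// -iE.
  rewrite -(Ex_cst P (sigma ^+ 2)^-1).
  apply: Ex_le => [||x]; [exact: Int_norm|exact: Int_cst|exact: test_diff_le].
have b2 : \int[P]_x (Tv x * `|f (W x + 1) - f (W x)|) <= sigma^-1 ^+ 2 * (sigma * c1).
  apply: (@le_trans _ _ (\int[P]_x (sigma^-1 ^+ 2 * Tv x))).
    apply: Ex_le => [||x]; last 2 first.
    - exact: IntZ.
    - by rewrite mulrC ler_wpM2r// -iE; exact: test_diff_le.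
    apply: (Int_mul_bounded P _ _ (sigma ^+ 2)^-1) => [//||x].
      exact: (mfW (fun k => `|f (k + 1) - f k|)).
    by rewrite normr_id; exact: test_diff_le.
  by rewrite RintegralZl// ler_wpM2l// exprn_ge0// ltW.
have h := test_core A (2 / sigma) B0 fB.
apply: (le_trans (stein_test_error A)); rewrite -/f iE.
have js : sigma^-1 * sigma = 1 by rewrite mulVf// lt0r_neq0.
have jle : sigma^-1 <= 5^-1 by rewrite lef_pV2// posrE.
move: h b1 b2; rewrite -/f; set I := `|_|; set a := `|_|; set t := \int[P]_x _.
have s0 := sigma0; have c1g := c1_ge1.
move: (sigma^-1) js jle j0 => j js jle j0 h b1 b2.
have : (sigma * c1 + 1) * a <= (sigma * c1 + 1) * j ^+ 2.
  by rewrite ler_wpM2l//; nra.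
have -> : (sigma * c1 + 1) * j ^+ 2 = (j * sigma) * c1 * j + j ^+ 2 by ring.
move: b2; have -> : j ^+ 2 * (sigma * c1) = (j * sigma) * c1 * j by ring.
rewrite js => b2 b3.
have : j ^+ 2 <= 5^-1 * j by rewrite expr2 ler_wpM2r// ltW.
nra.
Qed.

Section local_bound.
Variables (c2 q delta : R).
Hypotheses (sigma4 : 4 < sigma) (q2 : 2 <= q).
Hypotheses (q_ge : ln sigma <= q) (q_lt : q - 1 < ln sigma).
Hypothesis c2_ge0 : 0 <= c2.
Hypothesis NTv : ('N[P]_q%:E[EFin \o Tv] <= (sigma * c2)%:E)%E.
Notation err a := `|pr [set a] - TP_pmf mu (sigma ^+ 2) a|.
Hypothesis err_le : forall a, err a <= delta.
Notation M := (9 / 20 / sigma + delta).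
Notation i2 := ((sigma ^+ 2)^-1).
Notation pi := (@poisson_pmf R lam).

Let i2_gt0 : 0 < i2. Proof. by rewrite invr_gt0. Qed.
Let laminv_le : lam^-1 <= i2. Proof. by rewrite lef_pV2 ?posrE. Qed.
Let delta_ge0 : 0 <= delta. Proof. exact: le_trans (normr_ge0 _) (err_le 0). Qed.
Let M_gt0 : 0 < M.
Proof. by rewrite ltr_pwDl// !divr_gt0. Qed.

Let pi_le n : pi n <= 9 / 20 / sigma.
Proof.
have h := poisson_pmf_le_mode lam lam0 n; have p0 := poisson_pmf_ge0 lam n.
have ps0 : 0 <= pi n * sigma by rewrite mulr_ge0// ltW.
rewrite ler_pdivlMr// -(@ler_pXn2r _ 2)// ?nnegrE//.
apply: (@le_trans _ _ (lam * pi n ^+ 2)); last by apply: (le_trans h); rewrite expr2; lra.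
by rewrite exprMn mulrC ler_wpM2r// exprn_ge0.
Qed.

Lemma prob_point_le k : (P (W @^-1` [set k]) <= M%:E)%E.
Proof.
rewrite -EFin_prob_of lee_fin; have := err_le k.
suff : TP_pmf mu (sigma ^+ 2) k <= 9 / 20 / sigma by rewrite ler_norml; lra.
have [ks|[n ->]] := int_shiftP s k; last by rewrite TP_pmf_shift pi_le.
by rewrite TP_pmf_lt// !divr_ge0// ltW.
Qed.

Section point.
Variable n : nat.
Notation a := (s + n%:Z).
Notation fn := (stein_sol lam (pred1 n) (pi n)).
Notation dn := (fun w : nat => fn w.+1 - fn w).

Let test_set : (fun w : nat => s + w%:Z \in [set a]) = pred1 n.
Proof.
apply/funext => w /=; apply/idP/idP; rewrite inE /=.
  by move=> /addrI [->].
by move=> /eqP ->.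
Qed.

Let mass_point : poisson_mass lam (pred1 n) = pi n.
Proof.
have := esum_poisson_mass lam lam0 [set n].
rewrite esum_set1 ?lee_fin ?poisson_pmf_ge0// => -[->]; congr poisson_mass.
by apply/funext => w /=; apply/idP/idP; rewrite inE => /eqP.
Qed.

Let testE : stein_test [set a] = shift_fun s fn.
Proof. by rewrite /stein_test test_set mass_point. Qed.

Let test_diffE k : stein_test [set a] (k + 1) - stein_test [set a] k = shift_fun s dn k.
Proof. by rewrite stein_test_diffE test_set mass_point. Qed.

Definition off_diff (w : nat) : R := if w != n then `|dn w| else 0.

Let off_diff_ge0 w : 0 <= off_diff w.
Proof. by rewrite /off_diff; case: ifP. Qed.

Let dn_n : 0 <= dn n <= lam^-1.
Proof.
have := stein_point_diff_a lam lam0 n; rewrite pmulr_rge0// => /andP[-> h] /=.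
by rewrite -(ler_pM2l lam0) mulfV// lt0r_neq0.
Qed.

Let off_diff_sum N : \sum_(w < N) off_diff w <= dn n.
Proof.
by rewrite /off_diff -big_mkcond /=; exact: stein_point_variation.
Qed.

Let series_le (u : nat -> R) (C : R) : (forall w, 0 <= u w) ->
  (forall N, \sum_(w < N) u w <= C) ->
  (\sum_(k <oo) (shift_fun s u (int_enum k))%:E <= C%:E)%E.
Proof.
move=> u0 uC; rewrite sum_shift_fun//; apply: lime_le.
  by apply: is_cvg_nneseries => w _ _; rewrite lee_fin.
by apply: nearW => N; rewrite sumEFin lee_fin big_mkord.
Qed.

Let shift_ge0 (u : nat -> R) : (forall w, 0 <= u w) -> forall k, 0 <= shift_fun s u k.
Proof.
by move=> u0 k; have [ks|[w ->]] := int_shiftP s k; [rewrite shift_fun_lt|rewrite shift_fun_add].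
Qed.

Let mean_diff_le :
  `|\int[P]_x (stein_test [set a] (W x + 1) - stein_test [set a] (W x))| <= M * i2.
Proof.
have /andP[d0 d1] := dn_n.
have E k : stein_test [set a] (k + 1) - stein_test [set a] k =
    dn n * (k \in [set a])%:R - shift_fun s off_diff k.
  rewrite test_diffE; have [ks|[w ->]] := int_shiftP s k.
    rewrite !shift_fun_lt// subr0 (_ : (k \in [set a]) = false) ?mulr0//.
    by apply/negP; rewrite inE /= => kE; move: ks; rewrite kE gtrDl.
  rewrite !shift_fun_add (_ : (s + w%:Z \in [set a]) = (w == n)); last first.
    by have /(congr1 (@^~ w)) := test_set.
  rewrite /off_diff; have [->|wn] := eqVneq w n; first by rewrite mulr1 subr0.
  have /andP[_] := stein_point_diff_neq lam lam0 n w wn; rewrite pmulr_rle0// => h.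
  by rewrite mulr0 sub0r ler0_norm// opprK.
have Oint : (\int[P]_x (shift_fun s off_diff (W x))%:E <= (M * dn n)%:E)%E.
  apply: (integral_discrete_le P W fiberW (shift_fun s off_diff)).
  - exact: shift_ge0.
  - exact: ltW.
  - exact: prob_point_le.
  - exact: series_le.
have iO : Int (fun x => shift_fun s off_diff (W x)).
  apply: (Int_ge0 P _ _ _ _ Oint); first exact: mfW.
  by move=> x; exact: shift_ge0.
have O1 : \int[P]_x shift_fun s off_diff (W x) <= M * dn n.
  by rewrite -lee_fin Ex_EFin.
have O0 : 0 <= \int[P]_x shift_fun s off_diff (W x).
  by apply: Rintegral_ge0 => x _; exact: shift_ge0.
have -> : \int[P]_x (stein_test [set a] (W x + 1) - stein_test [set a] (W x)) =
    dn n * pr [set a] - \int[P]_x shift_fun s off_diff (W x).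
  rewrite -Ex_indic_W -RintegralZl// -RintegralB//; last exact: IntZ.
  by apply: eq_Rintegral => x _; exact: E.
have pM : pr [set a] <= M by rewrite -lee_fin EFin_prob_of prob_point_le.
have p0 := prob_of_ge0 [set a].
have m0 := M_gt0.
have dp : dn n * pr [set a] <= M * dn n by rewrite mulrC ler_wpM2r.
have dp0 : 0 <= dn n * pr [set a] by rewrite mulr_ge0.
have dM : M * dn n <= M * i2 by rewrite ler_pM2l// (le_trans d1).
by rewrite ler_norml; apply/andP; split; lra.
Qed.

Let p' := q / (q - 1).
Let q0 : 0 < q. Proof. by apply: lt_le_trans q2. Qed.
Let q1 : 0 < q - 1. Proof. have := q2; lra. Qed.
Let p'0 : 0 < p'. Proof. by rewrite divr_gt0. Qed.
Let conj_pq : q^-1 + p'^-1 = 1.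
Proof. by rewrite /p'; field; rewrite !lt0r_neq0. Qed.
Let p'1 : p' - 1 = (q - 1)^-1.
Proof. by rewrite /p'; field; exact: lt0r_neq0. Qed.

Let diff_T_le (r beta : R) : 0 <= r ->
  (forall w, w != n -> `|lam * dn w| <= r) ->
  1 + r `^ (q - 1)^-1 <= beta ->
  \int[P]_x (Tv x * `|stein_test [set a] (W x + 1) - stein_test [set a] (W x)|)
    <= expR 1 * c2 / sigma * Num.max sigma^-1 (beta * M).
Proof.
move=> r0 dr rb; set rho := r `^ (q - 1)^-1 in rb.
have rho0 : 0 <= rho by exact: powR_ge0.
have l0 := lam0; have li0 : 0 < lam^-1 by rewrite invr_gt0.
have p'10 : 0 < (q - 1)^-1 by rewrite invr_gt0.
pose psi w := `|dn w| `^ p'.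
have psi_le w : psi w <= lam^-1 `^ p' * ((w == n)%:R + rho * (lam * off_diff w)).
  rewrite /psi.
  have -> : `|dn w| = lam^-1 * `|lam * dn w|.
    by rewrite normrM (gtr0_norm l0) mulrA mulVf ?mul1r// lt0r_neq0.
  rewrite (powRM _ (ltW li0) (normr_ge0 _)); apply: ler_wpM2l; first exact: powR_ge0.
  rewrite /off_diff; have [->|wn] := eqVneq w n; rewrite /=.
    have one : (1 : R) `^ p' = 1 by rewrite powR1.
    rewrite !mulr0 addr0 -[leRHS]one; apply: ge0_ler_powR; rewrite ?nnegrE//.
      exact: ltW.
    have /andP[d0 d1] := stein_point_diff_a lam lam0 n.
    by rewrite ger0_norm.
  rewrite add0r; set v := `|_|; have v0 : 0 <= v by exact: normr_ge0.
  have -> : lam * `|dn w| = v by rewrite /v normrM (gtr0_norm l0).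
  have -> : p' = (q - 1)^-1 + 1 by rewrite -p'1 subrK.
  rewrite powRD ?powRr1//; last by apply/implyP; rewrite gt_eqF// ltr_wpDr// ltW.
  rewrite /rho; apply: ler_wpM2r => //; apply: ge0_ler_powR; rewrite ?nnegrE//; first exact: ltW.
  exact: dr.
have psi0 w : 0 <= psi w by exact: powR_ge0.
have ind_sum N : \sum_(w < N) (val w == n)%:R <= 1 :> R.
  suff -> : \sum_(w < N) (val w == n)%:R = (n < N)%:R :> R by rewrite lern1 leq_b1.
  elim: N => [|N IH]; first by rewrite big_ord0.
  rewrite big_ord_recr /= IH [in RHS]ltnS [in RHS]leq_eqVlt (eq_sym N).
  by have [<-|_] := eqVneq n N; rewrite ?ltnn ?add0r ?addr0.
have /andP[dn0 dn1] := dn_n.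
have psi_sum N : \sum_(w < N) psi w <= lam^-1 `^ p' * (1 + rho).
  apply: le_trans (ler_sum _ (fun w _ => psi_le (val w))) _.
  rewrite -mulr_sumr; apply: ler_wpM2l; first exact: powR_ge0.
  rewrite big_split /=; apply: lerD; first exact: ind_sum.
  rewrite -mulr_sumr -mulr_sumr ler_piMr// -(mulfV (lt0r_neq0 l0)) ler_pM2l//.
  by rewrite (le_trans (off_diff_sum N)).
pose Y x := `|stein_test [set a] (W x + 1) - stein_test [set a] (W x)|.
have mY : measurable_fun setT Y.
  exact: (mfW (fun k => `|stein_test [set a] (k + 1) - stein_test [set a] k|)).
have mTv : measurable_fun setT Tv by exact: Int_measurable iTv.
have m0 := M_gt0.
have r1 : 0 <= 1 + rho by rewrite addr_ge0.
have M1 : 0 <= M * (1 + rho) by apply: mulr_ge0 => //; exact: ltW.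
have L0 : 0 <= M * (lam^-1 `^ p' * (1 + rho)).
  by apply: mulr_ge0; [exact: ltW|apply: mulr_ge0 => //; exact: powR_ge0].
have YL : (\int[P]_x (`|Y x| `^ p')%:E <= (M * (lam^-1 `^ p' * (1 + rho)))%:E)%E.
  rewrite (eq_integral (fun x => (shift_fun s psi (W x))%:E)); last first.
    move=> x _; congr EFin; rewrite /Y normr_id test_diffE.
    have [ks|[w ->]] := int_shiftP s (W x); last by rewrite !shift_fun_add.
    by rewrite !shift_fun_lt// normr0 powR0// lt0r_neq0.
  apply: (integral_discrete_le P W fiberW (shift_fun s psi)).
  - exact: shift_ge0.
  - exact: ltW.
  - exact: prob_point_le.
  - exact: series_le.
have iTY : Int (fun x => Tv x * Y x).
  apply: (Int_mul_bounded P _ _ i2) => // x.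
  by rewrite /Y normr_id; exact: test_diff_le.
rewrite -lee_fin -[X in (X%:E <= _)%E]/(\int[P]_x (Tv x * Y x)) (Ex_EFin P _ iTY).
have hold := hoelder_moment_le P Tv Y q p' _ _ mTv mY q0 p'0 conj_pq L0 NTv YL.
apply: (@le_trans _ _ (\int[P]_x (`|Tv x * Y x|)%:E)%E).
  apply: ge0_le_integral_any => x.
    by rewrite lee_fin; apply: mulr_ge0 => //; exact: normr_ge0.
  by rewrite lee_fin ler_norm.
apply: (le_trans hold); rewrite lee_fin.
set Y0 := Num.max _ _.
have Y0_ge : sigma^-1 <= Y0 by rewrite le_max lexx.
have j0 : 0 < sigma^-1 by rewrite invr_gt0.
have Y0_gt0 : 0 < Y0 by exact: lt_le_trans Y0_ge.
have -> : (M * (lam^-1 `^ p' * (1 + rho))) `^ p'^-1 = lam^-1 * (M * (1 + rho)) `^ p'^-1.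
  rewrite mulrCA powRM ?powR_ge0//.
  by rewrite -powRrM mulfV ?lt0r_neq0// powRr1// ltW.
have Yle : (M * (1 + rho)) `^ p'^-1 <= expR 1 * Y0.
  apply: (@le_trans _ _ (Y0 `^ p'^-1)).
    apply: ge0_ler_powR; rewrite ?nnegrE; [by rewrite invr_ge0 ltW|exact: M1|exact: ltW|].
    by rewrite le_max [X in _ || X](_ : _ = true) ?orbT// mulrC ler_wpM2r// ltW.
  have -> : p'^-1 = - q^-1 + 1 by rewrite -conj_pq; ring.
  rewrite powRD ?powRr1 ?(ltW Y0_gt0)//; last by rewrite (gt_eqF Y0_gt0) implybT.
  apply: ler_wpM2r; first exact: ltW.
  rewrite /powR gt_eqF// ler_expR mulNr lerNl -(mulVf (lt0r_neq0 q0)) -mulrN.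
  apply: ler_wpM2l; first by rewrite invr_ge0 ltW.
  apply: (@le_trans _ _ (ln sigma^-1)); last by rewrite ler_ln ?posrE.
  by rewrite lnV ?posrE// lerN2.
have c20 := c2_ge0.
apply: (@le_trans _ _ (sigma * c2 * (i2 * (expR 1 * Y0)))).
  apply: ler_wpM2l; first by rewrite mulr_ge0// ltW.
  by apply: ler_pM => //; [exact: ltW|exact: powR_ge0].
rewrite le_eqVlt; apply/orP; left; apply/eqP.
by field; exact: lt0r_neq0.
Qed.

Lemma point_error_le (r beta : R) : 0 <= r ->
  (forall w, w != n -> `|lam * dn w| <= r) ->
  1 + r `^ (q - 1)^-1 <= beta ->
  sigma * err a <= 5 / 4 * (c1 / sigma) * (sigma * M)
    + expR 1 * c2 / sigma * Num.max 1 (beta * (sigma * M)) + 3 / 2 * (c1 / sigma).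
Proof.
move=> r0 dr rb.
have B0 : 0 < i2 by [].
have fB k : `|stein_test [set a] k| <= i2.
  rewrite testE; apply: shift_fun_normr_le => [|w]; first exact: ltW.
  apply: (le_trans _ laminv_le); rewrite -(ler_pM2l lam0) mulfV ?lt0r_neq0//.
  exact: stein_point_normr_le.
have h1 := test_core [set a] i2 B0 fB.
have above k : [set a] k -> s <= k by move=> ->; rewrite lerDl.
have h2 := stein_test_error_above [set a] above.
rewrite test_set mass_point in h2.
have h3 := mean_diff_le; have h4 := diff_T_le r beta r0 dr rb.
rewrite TP_pmf_shift.
move: h1 h2 h3 h4; set I := `|\int[P]_x (_ - _ * _)|; set e := `|_ - pi n|.
set b := `|\int[P]_x (_ - _)|; set t := \int[P]_x (Tv x * _) => h1 h2 h3 h4.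
have j0 : 0 < sigma^-1 by rewrite invr_gt0.
have j4 : sigma^-1 <= 4^-1 by rewrite lef_pV2 ?posrE// ltW.
have sj : sigma * sigma^-1 = 1 by rewrite mulfV// lt0r_neq0.
have iE : i2 = sigma^-1 * sigma^-1 by rewrite expr2 invfM.
have -> : Num.max 1 (beta * (sigma * M)) = sigma * Num.max sigma^-1 (beta * M).
  by rewrite maxr_pMr ?sj ?(ltW sigma0)// mulrCA.
have h5 := pi_le n; have m0 := M_gt0; have c1g := c1_ge1; have s0 := sigma0.
move: h3 h4 h1 h2 h5; rewrite iE.
set j := sigma^-1 in j0 j4 sj *; set Y0 := Num.max _ _; set E := expR 1.
move: M m0 => m m0 h3 h4 h1 h2 h5.
have k1 : (sigma * c1 + 1) * b <= (sigma * c1 + 1) * (m * (j * j)).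
  by apply: ler_wpM2l => //; rewrite addr_ge0// mulr_ge0; lra.
have k2 : sigma * ((sigma * c1 + 1) * (m * (j * j))) <= 5 / 4 * (c1 * j) * (sigma * m).
  have -> : sigma * ((sigma * c1 + 1) * (m * (j * j))) = (sigma * j) * ((sigma * j) * c1 + j) * m by ring.
  have -> : 5 / 4 * (c1 * j) * (sigma * m) = (sigma * j) * (5 / 4 * c1) * m by ring.
  by rewrite sj !mul1r ler_wpM2r; lra.
have k3 : pi n <= 1 / 2 by nra.
have k4 : sigma * (((c1 - 1) / 2 + c1) * (j * j) + pi n * (j * j)) <= 3 / 2 * (c1 * j).
  have -> : sigma * (((c1 - 1) / 2 + c1) * (j * j) + pi n * (j * j)) =
    (sigma * j) * (((c1 - 1) / 2 + c1 + pi n) * j) by ring.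
  by rewrite sj mul1r [leRHS]mulrA ler_wpM2r; lra.
have k5 : sigma * e <= sigma * ((sigma * c1 + 1) * (m * (j * j)) + E * c2 * j * Y0
    + (((c1 - 1) / 2 + c1) * (j * j) + pi n * (j * j))).
  by rewrite ler_pM2l//; lra.
apply: (le_trans k5); rewrite !mulrDr.
have -> : sigma * (E * c2 * j * Y0) = E * c2 * j * (sigma * Y0) by ring.
by move: k4; rewrite mulrDr; lra.
Qed.

Let sqrt_sigma : 0 < Num.sqrt sigma /\ Num.sqrt sigma ^+ 2 = sigma.
Proof. by rewrite sqrtr_gt0 sqr_sqrtr// ltW. Qed.

(* Chebyshev's inequality at the single point [a] bounds the distance from [a] to
   the mean, and off [n] the increments of the Stein solution are at most the
   relative distance to the mean plus the mass at [n]. *)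
Lemma diff_small_of_error : 3 / 2 + 27 / 2 * (c1 / sigma) < sigma * err a ->
  forall w, w != n -> `|lam * dn w| <= (Num.sqrt sigma)^-1.
Proof.
move=> bad w wn; have [v0 v2] := sqrt_sigma; set v := Num.sqrt sigma in v0 v2 *.
have s0 := sigma0; have s4 := sigma4; have c1g := c1_ge1; have l0 := lam0.
have p0 := poisson_pmf_ge0 lam n.
have pi9 := pi_le n; rewrite ler_pdivlMr// in pi9.
move: bad; rewrite TP_pmf_shift; set e := `|_ - pi n| => bad.
have xp : 0 < c1 / sigma by rewrite divr_gt0//; lra.
have pr_ge : e <= pr [set a].
  have pra := prob_of_ge0 [set a].
  have [h|h] := lerP (pi n) (pr [set a]).
    by rewrite /e ger0_norm ?subr_ge0// lerBlDr lerDl.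
  exfalso; have : e <= pi n by rewrite /e ltr0_norm ?subr_lt0//; lra.
  move=> ep; have : sigma * e <= sigma * pi n by rewrite ler_pM2l.
  lra.
have dist : (n%:R - lam) ^+ 2 * e <= sigma ^+ 2.
  have [z|z] := eqVneq (n%:R - lam) 0.
    by rewrite z expr0n /= mul0r exprn_ge0// ltW.
  have z0 : 0 < `|n%:R - lam| by rewrite normr_gt0.
  have aE : a%:~R - mu = n%:R - lam by rewrite intrD lamE -pmulrn; ring.
  have := cheb [set a] _ z0; rewrite -EFin_prob_of lee_fin real_normK ?num_real//.
  have z2 : 0 < (n%:R - lam) ^+ 2 by rewrite exprn_even_gt0.
  rewrite ler_pdivlMr// => /(_ _)/le_trans h.
  rewrite mulrC; apply: (le_trans (ler_wpM2r (ltW z2) pr_ge)).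
  by apply: h => // k /= ->; rewrite aE.
apply: (le_trans (stein_point_diff_small lam lam0 n w wn)).
have far : `|n%:R - lam| <= sigma * (v - 9 / 20).
  have vb : 2 < v.
    by rewrite -(@ltr_pXn2r _ 2)// ?nnegrE ?ltW// v2 expr2; lra.
  have rhs0 : 0 <= sigma * (v - 9 / 20) by rewrite mulr_ge0//; lra.
  rewrite -(@ler_pXn2r _ 2)// ?nnegrE// real_normK ?num_real//.
  have e0 : 0 < e by rewrite -(pmulr_rgt0 _ s0); lra.
  rewrite -(ler_pM2r e0) (le_trans dist)// exprMn -mulrA.
  apply: ler_peMr; first by rewrite exprn_ge0// ltW.
  have key : sigma <= (3 / 2 + 27 / 2 * sigma^-1) * (v - 9 / 20) ^+ 2.
    have [vs|vs] := lerP (5 / 2) v.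
      have : v ^+ 2 <= 3 / 2 * (v - 9 / 20) ^+ 2 by rewrite !expr2; nra.
      have : 0 <= 27 / 2 * sigma^-1 * (v - 9 / 20) ^+ 2.
        apply: mulr_ge0; last exact: sqr_ge0.
        by apply: mulr_ge0 => //; rewrite invr_ge0 ltW.
      by rewrite v2 mulrDl; lra.
    have s625 : sigma <= 25 / 4 by rewrite -v2 expr2; nra.
    have : 4 / 25 <= sigma^-1.
      by rewrite -[leLHS]invrK lef_pV2 ?posrE ?invf_div//; lra.
    move: (sigma^-1) => j j1.
    have : 2 <= (v - 9 / 20) ^+ 2 by rewrite expr2; nra.
    by move: ((v - 9 / 20) ^+ 2) => z z1; nra.
  have cj : sigma^-1 <= c1 / sigma by rewrite ler_peMl// invr_ge0 ltW.
  rewrite -(ler_pM2l s0) mulr1 mulrCA [leRHS]mulrC; apply: (le_trans key).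
  apply: ler_wpM2r; first exact: sqr_ge0.
  by apply: (le_trans _ (ltW bad)); lra.
have sl : sigma ^+ 2 <= lam := lam_ge.
apply: (@le_trans _ _ (9 / 20 / sigma + sigma * (v - 9 / 20) / sigma ^+ 2)).
  apply: lerD; first exact: pi_le.
  by apply: ler_pM => //; rewrite invr_ge0 ltW.
rewrite le_eqVlt; apply/orP; left; apply/eqP; rewrite -v2; field.
exact: lt0r_neq0.
Qed.

Lemma sqrt_pow_small : 1 + (Num.sqrt sigma)^-1 `^ (q - 1)^-1 <= 81 / 50.
Proof.
have [v0 v2] := sqrt_sigma; set v := Num.sqrt sigma in v0 v2 *.
have lnv : ln sigma = 2 * ln v by rewrite -v2 lnXn// mulr_natl.
have q10 := q1; have qs := q_lt.
have half : (q - 1)^-1 * ln v^-1 <= - 2^-1.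
  rewrite lnV ?posrE// mulrN lerN2 ler_pdivlMl//; lra.
have e12 : 13 / 8 <= expR (2^-1) :> R.
  by apply: le_trans (expR_ge_quad _ _); rewrite ?invr_ge0// expr2; lra.
have : v^-1 `^ (q - 1)^-1 <= 8 / 13.
  rewrite /powR gt_eqF ?invr_gt0//; apply: (@le_trans _ _ (expR (- 2^-1))).
    by rewrite ler_expR.
  by rewrite expRN -[leRHS]invrK invf_div lef_pV2 ?posrE ?expR_gt0//; lra.
lra.
Qed.
End point.

Lemma low_error a : a < s -> sigma * err a <= c1 / sigma.
Proof.
move=> als; rewrite TP_pmf_lt// subr0 ger0_norm ?prob_of_ge0//.
have : pr [set a] <= i2.
  apply: le_trans low_tail_le; rewrite -lee_fin !EFin_prob_of le_measure ?inE//.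
  by move=> x /= ->.
rewrite -(ler_pM2l sigma0) => /le_trans; apply.
rewrite expr2 invfM mulrA mulfV ?lt0r_neq0// mul1r ler_peMl//.
by rewrite invr_ge0 ltW.
Qed.

Hypothesis small : c1 + expR 1 * c2 < sigma / 2.
Hypothesis delta_least : forall e : R, (forall a, err a <= e) -> delta <= e.

(* Bounding [lam * dn w] by 1 gives the self-consistent inequality with the factor
   2 in front of [y], which suffices unless [5/4 x + 2 y > 3/4].  In that case an
   error above [16 x + 4 y] is large enough for [diff_small_of_error], and the
   factor drops to 81/50. *)
Lemma dloc_bound : delta <= 4 * (4 * c1 + expR 1 * c2) / sigma ^+ 2.
Proof.
have s0 := sigma0; have s4 := sigma4; have c1g := c1_ge1.
pose x := c1 / sigma; pose y := expR 1 * c2 / sigma; pose D := sigma * delta.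
have sN : sigma != 0 by exact: lt0r_neq0.
have x0 : 0 < x by rewrite divr_gt0//; lra.
have y0 : 0 <= y by rewrite divr_ge0 ?mulr_ge0 ?expR_ge0// ltW.
have xy : x + y < 1 / 2.
  by have sm := small; rewrite /x /y -mulrDl ltr_pdivrMr//; lra.
have D0 : 0 <= D by rewrite mulr_ge0// ltW.
have sM : sigma * M = 9 / 20 + D by rewrite /D; field.
have D_le C : (forall a, sigma * err a <= C) -> D <= C.
  move=> h; rewrite /D mulrC -ler_pdivlMr//; apply: delta_least => a.
  by rewrite ler_pdivlMr// mulrC.
suff : D <= 16 * x + 4 * y.
  rewrite /D mulrC -ler_pdivlMr// => h; apply: (le_trans h).
  by rewrite le_eqVlt; apply/orP; left; apply/eqP; rewrite /x /y; field.
have [I|II] := lerP (5 / 4 * x + 2 * y) (3 / 4).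
  have : D <= 5 / 4 * x * (1 / 2 + D) + y * (2 * (1 / 2 + D)) + 3 / 2 * x.
    apply: D_le => a; have [als|[n ->]] := int_shiftP s a.
      apply: (le_trans (low_error a als)); rewrite -/x.
      have : 0 <= 5 / 4 * x * (1 / 2 + D) by apply: mulr_ge0; lra.
      have : 0 <= y * (2 * (1 / 2 + D)) by apply: mulr_ge0; lra.
      lra.
    have := point_error_le n 1 2 ler01; rewrite sM powR1 => h; apply: (le_trans (h _ _)).
    - move=> w wn; have := stein_point_diff_neq lam lam0 n w wn.
      by rewrite ler_norml => /andP[-> h1] /=; lra.
    - lra.
    rewrite -/x -/y lerD2r; apply: lerD.
      by apply: ler_wpM2l; [rewrite mulr_ge0// ltW|lra].
    by apply: ler_wpM2l => //; rewrite ge_max; apply/andP; split; lra.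
  nra.
have [|big] := lerP D (16 * x + 4 * y); first by [].
have : D <= Num.max (16 * x + 4 * y)
    (5 / 4 * x * (9 / 20 + D) + y * (81 / 50 * (9 / 20 + D)) + 3 / 2 * x).
  apply: D_le => a; rewrite le_max.
  have [//|bad /=] := lerP (sigma * err a) (16 * x + 4 * y).
  have [als|[n aE]] := int_shiftP s a.
    by have := low_error a als; rewrite -/x; lra.
  rewrite aE in bad *.
  have bad' : 3 / 2 + 27 / 2 * (c1 / sigma) < sigma * err (s + n%:Z).
    by apply: le_lt_trans bad; rewrite -/x; lra.
  have v0 : 0 < Num.sqrt sigma by rewrite sqrtr_gt0.
  have := point_error_le n (Num.sqrt sigma)^-1 (81 / 50).
  rewrite sM invr_ge0 => h.
  apply: (le_trans (h (ltW v0) (diff_small_of_error n bad') sqrt_pow_small)).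
  rewrite -/x -/y lerD2r lerD2l; apply: ler_wpM2l => //.
  by rewrite ge_max lexx andbT; lra.
rewrite le_max leNgt big /= => h.
nra.
Qed.
End local_bound.
End from_core_bound.

Section distances.
Context {d : measure_display} {T : measurableType d} {R : realType}.
Variables (P : probability T R) (W : T -> int) (mu sigma2 : R).
Hypothesis fiberW : forall k, measurable (W @^-1` [set k]).
Hypothesis sigma20 : 0 < sigma2.

Lemma dTV_TP_le (C : R) :
  (forall A, `|prob_of P W A - poisson_mass (TP_rate mu sigma2)
      (fun n => (TP_shift mu sigma2 + n%:Z)%R \in A)| <= C) ->
  (dTV P W (TP_pmf mu sigma2) <= C%:E)%E.
Proof.
move=> h; apply: ge_ereal_sup => _ [A _ <-].
rewrite esum_TP_pmf// -(EFin_prob_of P W fiberW) -EFinB abse_EFin lee_fin.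
exact: h.
Qed.

Lemma dTV_TP_le1 : (dTV P W (TP_pmf mu sigma2) <= 1)%E.
Proof.
apply: dTV_TP_le => A.
have := prob_of_ge0 P W A; have := prob_of_le1 P W fiberW A.
have l0 := TP_rate_gt0 mu sigma2 sigma20.
have := poisson_mass_ge0 _ l0 (fun n => (TP_shift mu sigma2 + n%:Z)%R \in A).
have := poisson_mass_le1 _ l0 (fun n => (TP_shift mu sigma2 + n%:Z)%R \in A).
by rewrite ler_norml; lra.
Qed.

Notation err a := `|prob_of P W [set a] - TP_pmf mu sigma2 a|.

Lemma dloc_TP_le (C : R) : (forall a, err a <= C) ->
  (dloc P W (TP_pmf mu sigma2) <= C%:E)%E.
Proof.
move=> h; apply: ge_ereal_sup => _ [a _ <-].
rewrite -(EFin_prob_of P W fiberW) -EFinB abse_EFin lee_fin.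
exact: h.
Qed.

Lemma dloc_TP_ge a : ((err a)%:E <= dloc P W (TP_pmf mu sigma2))%E.
Proof.
apply: ereal_sup_ubound; exists a => //.
by rewrite -(EFin_prob_of P W fiberW) -EFinB abse_EFin.
Qed.

Lemma TP_pmf_itv a : 0 <= TP_pmf mu sigma2 a <= 1.
Proof.
have l0 := TP_rate_gt0 mu sigma2 sigma20.
have [h|[n ->]] := int_shiftP (TP_shift mu sigma2) a.
  by rewrite TP_pmf_lt// lexx ler01.
rewrite TP_pmf_shift poisson_pmf_ge0 /=.
have := poisson_cdf_le1 _ l0 n.+1; rewrite poisson_cdfS.
have := poisson_cdf_ge0 (TP_rate mu sigma2) n; lra.
Qed.

Lemma dloc_TP_le1 : (dloc P W (TP_pmf mu sigma2) <= 1)%E.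
Proof.
apply: dloc_TP_le => a; have /andP[q0 q1] := TP_pmf_itv a.
have := prob_of_ge0 P W [set a]; have := prob_of_le1 P W fiberW [set a].
by rewrite ler_norml; lra.
Qed.
End distances.

Lemma expR1_le4 {R : realType} : expR 1 <= 4 :> R.
Proof.
have h : 2^-1 <= expR (- 2^-1) :> R by apply: le_trans (expR_ge1Dx _); lra.
have e0 : 0 < expR (2^-1) :> R by exact: expR_gt0.
rewrite expRN lef_pV2 ?posrE// in h.
have -> : (1 : R) = 2^-1 + 2^-1 by field.
rewrite expRD; nra.
Qed.

Theorem mainTheorem2 (d : measure_display) (T : measurableType d) (R : realType)
  (P : probability T R)
  (W Wp : T -> int) (G Rr : T -> R) (mu sigma : R)
  (F1 F2 : set (set T)) (pW : int -> T -> R) (cGD : T -> R) :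
  let Wr := fun x => (W x)%:~R : R in
  let Wpr := fun x => (Wp x)%:~R : R in
  let D := fun x => (Wp x - W x)%:~R : R in
  (* random variables *)
  measurable_fun setT Wr -> measurable_fun setT Wpr ->
  measurable_fun setT G -> measurable_fun setT Rr ->
  (* (W, W', G, R) is an approximate Stein coupling *)
  (forall f : int -> R,
      P.-integrable setT (fun x => ((Wr x - mu) * f (W x))%:E) ->
      P.-integrable setT (fun x => (G x * (f (Wp x) - f (W x)))%:E) ->
      P.-integrable setT (fun x => (Rr x * f (W x))%:E) ->
      (\int[P]_x ((Wr x - mu) * f (W x))%:E
       = \int[P]_x (G x * (f (Wp x) - f (W x)))%:E
         + \int[P]_x (Rr x * f (W x))%:E)%E) ->
  (* E W = mu, Var W = sigma^2 > 0 *)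
  P.-integrable setT (fun x => (Wr x)%:E) ->
  (\int[P]_x (Wr x)%:E = mu%:E)%E ->
  0 < sigma ->
  (\int[P]_x ((Wr x - mu) ^+ 2)%:E = (sigma ^+ 2)%:E)%E ->
  (* sigma-algebras F1, F2 *)
  sub_sigma F1 -> sub_sigma F2 ->
  F_measurable F1 Wr -> F_measurable F2 G -> F_measurable F2 D ->
  (* pW is (a regular version of) the conditional law of W given F2 *)
  cond_law_version P F2 W pW ->
  (* cGD is a version of E[G D | F1] *)
  cond_exp_version P F1 (fun x => G x * D x) cGD ->
  let Ups := (\int[P]_x (`|G x * D x * (D x - 1)|%:E * S2 (fun k => pW k x)))%E in
  let Tv := fun x => `|cGD x - fine (\int[P]_y (G y * D y)%:E)%E| in
  let TP := TP_pmf mu (sigma ^+ 2) in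
  forall c1 : R,
    (Ups + 1 <= c1%:E)%E ->
    ('N[P]_2%:E[EFin \o Rr] <= c1%:E)%E ->
    ((sigma^-1)%:E * 'N[P]_2%:E[EFin \o Tv] <= c1%:E)%E ->
    (dTV P W TP <= (5 * c1 / sigma)%:E)%E /\
    (forall c2 : R,
      ((sigma^-1)%:E * 'N[P]_((Num.ceil (ln sigma))%:~R)%:E[EFin \o Tv] <= c2%:E)%E ->
      c1 + expR 1 * c2 < sigma / 2 ->
      (dloc P W TP <= (4 * (4 * c1 + expR 1 * c2) / sigma ^+ 2)%:E)%E).
Proof.
move=> Wr Wpr D mWr mWpr mG mR coupling iW EW sigma0 VW sF1 sF2 F1W F2G F2D lawW condGD.
move=> Ups Tv TP c1 Ups_le R_le T_le.
have fiberW := measurable_int_fiber W mWr.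
have s20 : 0 < sigma ^+ 2 by rewrite exprn_gt0.
have c1_ge1 : 1 <= c1 := coupling_c1_ge1 P W Wp G F2 pW c1 lawW Ups_le.
have core := stein_coupling_bound P W Wp G Rr mu sigma F1 F2 pW cGD c1 mWr mWpr mG mR
  coupling iW EW sigma0 VW sF2 F1W F2G F2D lawW condGD Ups_le R_le.
have cheb := chebyshev_W P W mu sigma mWr iW VW.
have Tv0 x : 0 <= Tv x by exact: normr_ge0.
have iTv : P.-integrable setT (EFin \o Tv).
  have [_ _ icGD _] := condGD.
  exact: (Int_norm P _ (IntB P _ _ icGD (Int_cst P _))).
have mTv : measurable_fun setT Tv := Int_measurable P _ iTv.
have sc0 : 0 < sigma * c1 by rewrite mulr_gt0//; lra.
have ETv : \int[P]_x Tv x <= sigma * c1.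
  have N2 : ('N[P]_2%:E[EFin \o Tv] <= (sigma * c1)%:E)%E.
    by rewrite EFinM -lee_pdivrMl.
  have [i2 E2] := Lnorm2_le P Tv _ mTv (ltW sc0) N2.
  have := Ex_mul_sqr_le P Tv (fun=> 1) _ 1 mTv (measurable_cst _) i2 (Int_cst P _) sc0 ltr01 E2.
  rewrite Ex_cst mulr1 => /(_ (lexx _)).
  by under eq_Rintegral do rewrite mulr1 ger0_norm//.
split.
  have [big|small] := lerP 1 (5 * c1 / sigma).
    by apply: (le_trans (dTV_TP_le1 P W mu _ fiberW s20)); rewrite lee_fin.
  apply: dTV_TP_le => // A.
  apply: (dTV_bound P W mu sigma c1 Tv) => //.
  by move: small; rewrite ltr_pdivrMr// mul1r; lra.
move=> c2 N_le small.
have c20 : 0 <= c2.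
  rewrite -lee_fin; apply: le_trans N_le; apply: mule_ge0; last exact: Lnorm_ge0.
  by rewrite lee_fin invr_ge0 ltW.
have ec2 : 0 <= expR 1 * c2 by rewrite mulr_ge0// expR_ge0.
have [big|tiny] := lerP 1 (4 * (4 * c1 + expR 1 * c2) / sigma ^+ 2).
  by apply: (le_trans (dloc_TP_le1 P W mu _ fiberW s20)); rewrite lee_fin.
have s4 : 4 < sigma.
  move: tiny; rewrite ltr_pdivrMr// mul1r => tiny.
  by rewrite -(@ltr_pXn2r _ 2)// ?nnegrE ?(ltW sigma0)//; rewrite [ltLHS]expr2; lra.
have ln1 : 1 < ln sigma.
  rewrite -[ltLHS]expRK ltr_ln ?posrE ?expR_gt0//.
  exact: le_lt_trans expR1_le4 s4.
pose q : R := (Num.ceil (ln sigma))%:~R.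
have q_ge : ln sigma <= q by exact: ceil_ge.
have q_lt : q - 1 < ln sigma by have := ceilB1_lt (ln sigma); rewrite intrB.
have q2 : 2 <= q.
  rewrite /q (ler_int _ 2) -[leLHS]/(1 + 1) -ltzD1 ltrD2r -(ltr_int R).
  exact: lt_le_trans q_ge.
have Nq : ('N[P]_q%:E[EFin \o Tv] <= (sigma * c2)%:E)%E by rewrite EFinM -lee_pdivrMl.
have loc_ge a := dloc_TP_ge P W mu (sigma ^+ 2) fiberW a.
have loc_fin : dloc P W TP \is a fin_num.
  rewrite ge0_fin_numE; first exact: le_lt_trans (dloc_TP_le1 P W mu _ fiberW s20) (ltry _).
  by apply: le_trans (loc_ge 0); rewrite lee_fin.
rewrite -(fineK loc_fin) lee_fin.
apply: (dloc_bound P W mu sigma c1 Tv fiberW sigma0 c1_ge1 Tv0 iTv core cheb c2 q) => //.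
- by move=> a; rewrite -lee_fin fineK//; exact: loc_ge.
- move=> e he; rewrite -lee_fin fineK//; exact: dloc_TP_le.
Qed.
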